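(* Let $r\in(0,\infty)$ and let $P$ be an absolutely continuous Borel probability measure on $\mathbb{R}^d$ with density $h$ and $\int\|x\|^{r+\delta}\,dP(x)<\infty$ for some $\delta>0$. Then there exist constants $c_{27},c_{28},c_{31},c_{32},c_{33},c_{34}>0$ such that, for every nonempty compact set $K$ contained in the interior of $\operatorname{supp}(P)$, the following hold: $$\limsup_{n\to\infty}\ n\max_{a\in\alpha_n(K)}P(W(a\mid\alpha_n))\le c_{27}\inf_{\varepsilon>0}\frac{\|h\|_{K_\varepsilon}}{(\operatorname{essinf}h_{|K_\varepsilon})^{\frac{d}{r+d}}},$$ $$\limsup_{n\to\infty}\ n^{1+r/d}\max_{a\in\alpha_n(K)}\int_{W(a\mid\alpha_n)}\|x-a\|^r\,dP(x)\le c_{28}\inf_{\varepsilon>0}\frac{\|h\|_{K_\varepsilon}}{\operatorname{essinf}h_{|K_\varepsilon}},$$ $$\liminf_{n\to\infty}\ n\min_{a\in\alpha_n(K)}P(W_0(a\mid\alpha_n))\ge\begin{cases}c_{31}\sup_{\varepsilon>0}\Big(\dfrac{\operatorname{essinf}h_{|K_\varepsilon}}{\|h\|_{K_\varepsilon}}\Big)^{d}(\operatorname{essinf}h_{|K_\varepsilon})^{\frac{r}{r+d}},& r\ge1,\\[2mm] c_{32}\sup_{\varepsilon>0}\Big(\dfrac{\operatorname{essinf}h_{|K_\varepsilon}}{\|h\|_{K_\varepsilon}}\Big)^{d/r}(\operatorname{essinf}h_{|K_\varepsilon})^{\frac{r}{r+d}},&0<r<1,\end{cases}$$ $$\liminf_{n\to\infty}\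 n^{1+r/d}\min_{a\in\alpha_n(K)}\int_{W_0(a\mid\alpha_n)}\|x-a\|^r\,dP(x)\ge\begin{cases}c_{33}\sup_{\varepsilon>0}\Big(\dfrac{\operatorname{essinf}h_{|K_\varepsilon}}{\|h\|_{K_\varepsilon}}\Big)^{r+d},& r\ge1,\\[2mm] c_{34}\sup_{\varepsilon>0}\Big(\dfrac{\operatorname{essinf}h_{|K_\varepsilon}}{\|h\|_{K_\varepsilon}}\Big)^{1+d/r},&0<r<1.\end{cases}$$
   Context: $\|\cdot\|$ is an arbitrary fixed norm on $\mathbb{R}^d$, $d\ge1$; $\lambda^d$ is Lebesgue measure; $d(x,A)=\inf_{a\in A}\|x-a\|$ with $d(x,\varnothing)=+\infty$. For each $n\in\mathbb{N}$, $\alpha_n$ is an arbitrary fixed $n$-optimal codebook of order $r$ for $P$: $\operatorname{card}(\alpha_n)\le n$ and $\int d(x,\alpha_n)^r\,dP(x)=\inf\{\int d(x,\alpha)^r\,dP(x):\alpha\subset\mathbb{R}^d,\ 1\le\operatorname{card}(\alpha)\le n\}$ (it has exactly $n$ elements). For $a\in\alpha_n$: $W(a\mid\alpha_n)=\{x:\|x-a\|=d(x,\alpha_n)\}$, $W_0(a\mid\alpha_n)=\{x:\|x-a\|<d(x,\alpha_n\setminus\{a\})\}$. For compact $K$: $\alpha_n(K)=\{a\in\alpha_n:W(a\mid\alpha_n)\cap K\ne\varnothing\}$ and $K_\varepsilon=\{y\in\mathbb{R}^d:d(y,K)\le\varepsilon\}$. $\|h\|_B=\operatorname{esssup}h_{|B}$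 and $\operatorname{essinf}$ are taken with respect to $\lambda^d$. Conventions: a quotient with positive (possibly infinite) numerator and denominator $0$, or with infinite numerator and finite denominator, is $+\infty$; a quotient with finite numerator and infinite denominator is $0$. *)

(* Defs.v *)
From HB Require Import structures.
From mathcomp Require Import all_boot all_order all_algebra.
From mathcomp Require Import all_classical all_reals all_analysis.
From mathcomp Require Import measurable_realfun ess_sup_inf.

Set Implicit Arguments.
Unset Strict Implicit.
Unset Printing Implicit Defensive.

Import Order.TTheory GRing.Theory Num.Def Num.Theory.
Import numFieldNormedType.Exports.

Local Open Scope classical_set_scope.
Local Open Scope ring_scope.

(* Matrices (hence 'rV[R]_d) carry the Borel sigma-algebra of the product
   topology, which is the topology of every norm. *)
HB.instance Definition _ (R : realType) (m n : nat) :=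
  @isMeasurable.Build (sigma_display (@open 'M[R]_(m, n))) 'M[R]_(m, n)
    <<s @open 'M[R]_(m, n) >> (@sigma_algebra0 _ setT _) (@sigma_algebraC _ _)
    (@sigma_algebra_bigcup _ setT _).

Section measurability_rV.
Context (R : realType) (n : nat).

Let box (x : 'rV[rat]_n) (e : rat) : set 'rV[R]_n :=
  [set v | forall i, ball (ratr (x 0 i) : R) (ratr e) (v 0 i)].

Let open_box (U : set 'rV[R]_n) : open U ->
  U = \bigcup_(xe in [set xe : 'rV[rat]_n * rat | box xe.1 xe.2 `<=` U])
        box xe.1 xe.2.
Proof.
move=> oU; apply/seteqP; split=> [v Uv|v [xe xeU xev]]; last exact: xeU.
have /nbhs_ballP[e /= e0 veU] : nbhs v U by exact: open_nbhs_nbhs.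
have [q /andP[q0 qe]] : exists q : rat, (0 < ratr q :> R) && (ratr q < e / 2).
  have [|q] := @rat_in_itvoo R 0 (e / 2); first by rewrite divr_gt0.
  by rewrite in_itv/= => ?; exists q.
have xE i : exists x : rat, `|ratr x - v 0 i| < ratr q.
  have [|x] := @rat_in_itvoo R (v 0 i - ratr q) (v 0 i + ratr q).
    by rewrite ltrD2l gtrN.
  by rewrite in_itv/= -ltr_distl => ?; exists x.
exists (\row_i sval (cid (xE i)), q) => /=.
- move=> w xw; apply: veU; split => // j i; rewrite !ord1.
  move: (xw i); rewrite mxE /ball/=; case: cid => x /= xv xwi.
  rewrite (le_lt_trans (ler_distD (ratr x) _ _))// (splitr e) ltrD//.
    by rewrite distrC (lt_trans xv).
  by rewrite (lt_trans xwi).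
- by move=> i; rewrite mxE /ball/=; case: cid.
Qed.

Lemma measurable_fun_rV d (T : measurableType d) (f : T -> 'rV[R]_n) :
  (forall i, measurable_fun setT (fun t => f t 0 i)) -> measurable_fun setT f.
Proof.
move=> mf; apply: (@measurability _ _ _ _ setT f (@open 'rV[R]_n)) => //.
move=> _ [U oU <-]; rewrite setTI (open_box oU) preimage_bigcup bigcup_mkcond.
apply: countable_bigcupT_measurable => // -[x e]; case: ifPn => // _.
rewrite (_ : _ @^-1` _ =
    \bigcap_(i in [set: 'I_n]) (fun t => f t 0 i) @^-1`
      ball (ratr (x 0 i) : R) (ratr e)).
  apply: fin_bigcap_measurable => // i _; rewrite -[X in measurable X]setTI.
  by apply: mf => //; rewrite ball_itv; exact: measurable_itv.
by apply/seteqP; split => [t xt i _|t xt i]; exact: xt.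
Qed.

Lemma measurable_coord_rV (i : 'I_n) :
  measurable_fun setT (fun v : 'rV[R]_n => v 0 i).
Proof.
apply: (measurability _ (RGenOpens.measurableE R)) => _ [_ [a [b ->]] <-].
rewrite setTI; apply: sub_sigma_algebra; apply: open_comp; last exact: interval_open.
by move=> v _; exact: coord_continuous.
Qed.

End measurability_rV.

Definition rV_cons (R : realType) (n : nat)
    (p : measurableTypeR R * 'rV[R]_n) : 'rV[R]_(1 + n) :=
  row_mx (const_mx p.1) p.2.

Lemma measurable_rV_cons (R : realType) (n : nat) :
  measurable_fun setT (@rV_cons R n).
Proof.
apply: measurable_fun_rV => i; case: (split_ordP i) => j ->.
- rewrite (_ : (fun _ => _) = fst); first exact: measurable_fst.
  by apply/funext => p; rewrite /rV_cons row_mxEl mxE.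
- rewrite (_ : (fun _ => _) = (fun v : 'rV[R]_n => v 0 j) \o snd).
    by apply: measurableT_comp; [exact: measurable_coord_rV|exact: measurable_snd].
  by apply/funext => p; rewrite /rV_cons row_mxEr.
Qed.

Section lebesgue_rV.
Context (R : realType).
Local Open Scope ereal_scope.

Section step.
Context (n : nat) (mu : {sigma_finite_measure set 'rV[R]_n -> \bar R}).

Definition lebesgue_rV_step : set 'rV[R]_(1 + n) -> \bar R :=
  pushforward (lebesgue_measure \x mu) (@rV_cons R n).

HB.instance Definition _ := Measure.copy lebesgue_rV_step
  (measure_function_pushforward__canonical__measure_function_Measure
     (lebesgue_measure \x mu) (@measurable_rV_cons R n)).

Let sigma_finite_step : sigma_finite setT lebesgue_rV_step.
Proof.
pose g (v : 'rV[R]_(1 + n)) : measurableTypeR R * 'rV[R]_n :=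
  (lsubmx v ord0 ord0, rsubmx v).
have mg : measurable_fun setT g.
  apply: measurable_fun_pair => /=.
    rewrite (_ : (fun _ => _) = fun v : 'rV[R]_(1 + n) => v ord0 (lshift n ord0)).
      exact: measurable_coord_rV.
    by apply/funext => v; rewrite mxE.
  apply: measurable_fun_rV => i.
  rewrite (_ : (fun _ => _) = fun v : 'rV[R]_(1 + n) => v ord0 (rshift 1 i)).
    exact: measurable_coord_rV.
  by apply/funext => v; rewrite mxE.
have consK : cancel (@rV_cons R n) g.
  by move=> [x v]; rewrite /g row_mxKl row_mxKr mxE.
have /sigma_finiteP[F [TF ndF Foo]] := sigma_finiteT (@lebesgue_measure R).
have /sigma_finiteP[G [TG ndG Goo]] := sigma_finiteT mu.
exists (fun k => g @^-1` (F k `*` G k)).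
  apply/seteqP; split => // v _.
  have [k _ Fk] : (\bigcup_k F k) (g v).1 by rewrite -TF.
  have [l _ Gl] : (\bigcup_k G k) (g v).2 by rewrite -TG.
  exists (maxn k l) => //; split.
    by move: Fk; exact/subsetPset/ndF/leq_maxl.
  by move: Gl; exact/subsetPset/ndG/leq_maxr.
move=> k; have [mF Fk] := Foo k; have [mG Gk] := Goo k; split.
  by rewrite -[X in measurable X]setTI; apply: mg => //; exact: measurableX.
rewrite /lebesgue_rV_step /pushforward -comp_preimage.
rewrite (_ : _ \o _ = id); last by apply/funext => p; exact: consK.
by rewrite preimage_id product_measure1E// lte_mul_pinfty// ge0_fin_numE.
Qed.

HB.instance Definition _ :=
  Measure_isSigmaFinite.Build _ _ _ lebesgue_rV_step sigma_finite_step.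

End step.

(* Lebesgue measure on R^n as the n-fold product of Lebesgue measure on R; see
   lebesgue_rV_box for its values on boxes. *)
Fixpoint lebesgue_rV (n : nat) : {sigma_finite_measure set 'rV[R]_n -> \bar R} :=
  match n with
  | 0 => dirac (0%R : 'rV[R]_0)
  | n'.+1 => lebesgue_rV_step (lebesgue_rV n')
  end.

End lebesgue_rV.

Lemma rV_cons0 (R : realType) (n : nat) (p : measurableTypeR R * 'rV[R]_n) :
  @rV_cons R n p 0 ord0 = p.1.
Proof.
transitivity (@rV_cons R n p 0 (lshift n ord0)).
  by congr (_ _ _); exact: val_inj.
by rewrite /rV_cons row_mxEl mxE.
Qed.

Lemma rV_consS (R : realType) (n : nat) (p : measurableTypeR R * 'rV[R]_n)
  (i : 'I_n) : @rV_cons R n p 0 (lift ord0 i) = p.2 0 i.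
Proof.
transitivity (@rV_cons R n p 0 (rshift 1 i)).
  by congr (_ _ _); exact: val_inj.
by rewrite /rV_cons row_mxEr.
Qed.

Lemma lebesgue_rV_box (R : realType) (n : nat) (a b : 'I_n -> R) :
  (forall i, a i <= b i) ->
  lebesgue_rV R n [set v | forall i, a i <= v 0 i <= b i] =
  (\prod_(i < n) (b i - a i))%:E.
Proof.
elim: n a b => [|n IHn] a b ab.
  by rewrite big_ord0 /= diracE mem_set//; case.
rewrite big_ord_recl EFinM.
have mbox : measurable [set v : 'rV[R]_n |
    forall i, a (lift ord0 i) <= v 0 i <= b (lift ord0 i)].
  rewrite (_ : mkset _ = \bigcap_(i in [set: 'I_n]) (fun v : 'rV[R]_n => v 0 i)
      @^-1` `[a (lift ord0 i), b (lift ord0 i)]%classic).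
    apply: fin_bigcap_measurable => // i _; rewrite -[X in measurable X]setTI.
    exact: measurable_coord_rV.
  by apply/seteqP; split => v /= vab i; move: (vab i); rewrite /= in_itv/=; auto.
rewrite -IHn; last by move=> i; exact: ab.
have <- : lebesgue_measure
    (`[a ord0, b ord0]%classic : set (measurableTypeR R)) = (b ord0 - a ord0)%:E.
  rewrite lebesgue_measure_itv/= lte_fin; case: ltP => // ba.
  by rewrite (@le_anti _ _ (a ord0) (b ord0)) ?subrr// ab.
rewrite -(product_measure1E (@lebesgue_measure R) (lebesgue_rV R n))//.
rewrite /= /lebesgue_rV_step /pushforward; congr product_measure1.
apply/seteqP; split => [[x v] /= xv|[x v] /= [xab vab] i].
  split; first by have := xv ord0; rewrite rV_cons0 /= in_itv/=.
  by move=> i; have := xv (lift ord0 i); rewrite rV_consS.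
case: (unliftP ord0 i) => [j ->|->]; first by rewrite rV_consS; exact: vab.
by rewrite rV_cons0; move: xab; rewrite /= in_itv/=.
Qed.

(* Essential supremum and infimum over B: outside B the function takes the
   value that is neutral for the supremum (resp. infimum). *)
Definition ess_sup_on d (T : measurableType d) (R : realType)
    (mu : {measure set T -> \bar R}) (B : set T) (f : T -> R) : \bar R :=
  ess_sup mu (patch (cst -oo%E) B (EFin \o f)).

Definition ess_inf_on d (T : measurableType d) (R : realType)
    (mu : {measure set T -> \bar R}) (B : set T) (f : T -> R) : \bar R :=
  ess_inf mu (patch (cst +oo%E) B (EFin \o f)).

Section quantization.
Context (R : realType) (d : nat).
Implicit Types (N h : 'rV[R]_d -> R) (A K : set 'rV[R]_d) (a x : 'rV[R]_d).
Implicit Types (r e : R) (P : probability 'rV[R]_d R).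

Definition is_norm N : Prop :=
  [/\ forall x y, N (x + y) <= N x + N y,
      forall (c : R) x, N (c *: x) = `|c| * N x &
      forall x, N x = 0 -> x = 0].

Definition is_density P h : Prop :=
  [/\ measurable_fun setT h, forall x, 0 <= h x &
      forall A, measurable A ->
        P A = (\int[lebesgue_rV R d]_(x in A) (h x)%:E)%E].

Definition supp P : set 'rV[R]_d :=
  [set x | forall U, open_nbhs x U -> (0 < P U)%E].

(* Extended-real valued, so that dist N x set0 = +oo (and its r-th power too
   when 0 < r). *)
Definition dist N x A : \bar R := ereal_inf [set (N (x - a))%:E | a in A].

Definition distortion N r P A : \bar R := (\int[P]_x (dist N x A `^ r))%E.

Definition optimal_codebook N r P (n : nat) A : Prop :=
  (A #<= `I_n)%card /\
  distortion N r P A =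
    ereal_inf [set distortion N r P B
              | B in [set B | B !=set0 /\ (B #<= `I_n)%card]].

Definition voronoi N A a : set 'rV[R]_d :=
  [set x | (N (x - a))%:E = dist N x A].

Definition open_voronoi N A a : set 'rV[R]_d :=
  [set x | ((N (x - a))%:E < dist N x (A `\ a))%E].

(* For an optimal codebook A and nonempty K this set is finite and nonempty, so
   that extended-real suprema and infima over it are maxima and minima. *)
Definition near_codebook N A K : set 'rV[R]_d :=
  [set a | A a /\ voronoi N A a `&` K !=set0].

Definition thickening N K e : set 'rV[R]_d :=
  [set y | (dist N y K <= e%:E)%E].

Definition local_inertia N r P (D : set 'rV[R]_d) a : \bar R :=
  (\int[P]_(x in D) (N (x - a) `^ r)%:E)%E.

End quantization.

(* Main.v *)
Require Import Defs.
From mathcomp Require Import all_boot all_order all_algebra.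
From mathcomp Require Import all_classical all_reals all_analysis.
From mathcomp Require Import measurable_realfun ess_sup_inf ring lra.

Set Implicit Arguments.
Unset Strict Implicit.
Unset Printing Implicit Defensive.

Import Order.TTheory GRing.Theory Num.Def Num.Theory.
Import numFieldNormedType.Exports.

Local Open Scope classical_set_scope.
Local Open Scope ring_scope.

(** Write E(n) for the n-optimal distortion and tau(n) = n^(-1/d).  Everything
    follows from two-sided control of the increments of E:
      c * tau(n)^r / n <= E(n-1) - E(n) <= C * tau(n)^r / n     (n large).

    Upper estimate ([err_drop_point]).  By the Pierce bound ([pierce]),
    E(n) <= C0 * tau(n)^r: the images of a uniform grid under a map with
    polynomial tails give a codebook at distance O(tau(n) * (1 + |x|)^(1 + eta))
    from each x, where r * eta <= delta, and the moment of order r + delta is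
    finite.  Since P charges a bounded set on which h is bounded, this forces an
    optimal codebook to have at least k * n points in a fixed ball, and a grid
    argument ([size_isolated]) shows that at least half as many of them have a
    neighbour at distance O(tau(n)).  At a given x, deleting a codebook point changes the
    distance only if that point was the nearest one; summing over the points
    with a neighbour ([sum_err_rem]) shows that the deletions together cost
    O(tau(n)^r), hence one of them costs O(tau(n)^r / n).

    Lower estimate ([err_add_point]).  Adding y to a codebook at distance at
    least t from y lowers the distortion by at least a constant times
    t^r * P(B(y, t/4)) ([err_gain]).  With t of order tau(n), the t-neighbourhood
    of the codebook misses half of the mass of the bounded set above, and
    pigeonholing what is left in a grid yields a y with P(B(y, t/4)) of order 1/n.

    Now let m <= h <= M almost everywhere near K.  The gain inequality and the
    upper estimate give d(y, alpha_n) <= rho = G * m^(-1/(r+d)) * tau(n) for all y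
    near K ([qdist_small]).  Cells are star-shaped ([voronoi_star]), so a cell
    meeting K lies in the ball of radius rho about its centre
    ([voronoi_sub_nball]); integrating h <= M over that ball gives both upper
    bounds.  The centre a also has a neighbour within 3 * rho, so deleting it
    costs at most (4 * rho)^r * P(W_0(a)); by the lower estimate P(W_0(a)) is at
    least a constant times m^(r/(r+d)) / n ([open_voronoi_prob_ge]).  As h <= M, a
    suitable ball about a carries at most half of this mass, whence the local
    inertia is at least a constant times (m/M)^(r/d) * tau(n)^r / n
    ([open_voronoi_inertia_ge]).  Since m <= M, these bounds imply the stated
    ones, in both ranges of r and with the same constants. *)

(** * Norms on row vectors and volumes of their balls *)

Section norm.
Context (R : realType) (d : nat) (N : 'rV[R]_d -> R) (hN : is_norm N).

Lemma normD x y : N (x + y) <= N x + N y. Proof. by case: hN. Qed.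

Lemma normZ c x : N (c *: x) = `|c| * N x. Proof. by case: hN. Qed.

Lemma norm0 : N 0 = 0. Proof. by rewrite -(scale0r 0) normZ normr0 mul0r. Qed.

Lemma normN x : N (- x) = N x.
Proof. by rewrite -scaleN1r normZ normrN1 mul1r. Qed.

Lemma normBC x y : N (x - y) = N (y - x).
Proof. by rewrite -normN opprB. Qed.

Lemma norm_ge0 x : 0 <= N x.
Proof.
have := normD x (- x); rewrite normN subrr norm0.
lra.
Qed.

Lemma normBD z x y : N (x - y) <= N (x - z) + N (z - y).
Proof. by rewrite -(subrKA z x) normD. Qed.

Lemma normB_dist x y : `|N x - N y| <= N (x - y).
Proof.
rewrite ler_distl.
have := normD y (x - y); have := normD x (y - x).
rewrite !subrKC normBC; lra.
Qed.

(** N is dominated by the supremum norm, which is the norm of row vectors. *)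
Lemma norm_le_mxnorm : exists2 C : R, 0 < C & forall x, N x <= C * `|x|.
Proof.
exists (1 + \sum_i N (delta_mx 0 i)).
  by rewrite ltr_pwDl// sumr_ge0// => i _; exact: norm_ge0.
move=> x; rewrite {1}[x]row_sum_delta.
apply: (@le_trans _ _ (\sum_i `|x| * N (delta_mx 0 i))).
  elim/big_ind2 : _ => [|a b a' b' ab ab'|i _]; first by rewrite norm0.
    by rewrite (le_trans (normD _ _))// lerD.
  rewrite normZ ler_wpM2r ?norm_ge0//.
  by rewrite [leRHS]mx_normrE (le_bigmax _ _ (0, i)).
by rewrite -mulr_sumr mulrC ler_wpM2r// lerDr.
Qed.

Lemma is_norm_continuous : continuous N.
Proof.
have [C C0 NC] := norm_le_mxnorm.
move=> x; apply/(@cvgrPdist_lt _ R^o _ (nbhs x) (nbhs_filter x)) => e e0.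
apply/(@nbhs_normP R 'rV[R]_d x); exists (e / C); first by rewrite /= divr_gt0.
move=> y /= xy; rewrite (le_lt_trans (normB_dist _ _))// (le_lt_trans (NC _))//.
by rewrite mulrC -ltr_pdivlMr.
Qed.

(** Equivalence of norms: N attains a positive minimum on the compact unit sphere
    of the supremum norm. *)
Lemma mxnorm_le_norm : exists2 c : R, 0 < c & forall x, c * `|x| <= N x.
Proof.
pose S := [set x : 'rV[R]_d | `|x| = 1].
have [S0|S0] := pselect (S !=set0); last first.
  exists 1 => // x; have [->|x0] := eqVneq x 0.
    by rewrite normr0 mulr0 norm_ge0.
  case: S0; exists (`|x|^-1 *: x).
  by rewrite /S /= normrZ normfV normr_id mulVf// normr_eq0.
have cS : compact S.
  apply: bounded_closed_compact.
    exists 1; split; first exact: num_real.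
    by move=> M M1 x /= ->; exact: ltW.
  rewrite (_ : S = (fun x : 'rV[R]_d => `|x|) @^-1` [set 1]); last by [].
  apply: closed_comp; last exact: closed_eq.
  by move=> x _; exact: norm_continuous.
have [|c cS' cmin] := @EVT_min_rV R d N S S0 cS.
  exact/continuous_subspaceT/is_norm_continuous.
move: cS'; rewrite inE => cS'.
exists (N c).
  have [_ _ N0] := hN.
  rewrite lt_neqAle norm_ge0 andbT eq_sym; apply/eqP => /N0 c0.
  move: cS'; rewrite /S /= c0 normr0 => /esym/eqP.
  by rewrite oner_eq0.
move=> x; have [->|x0] := eqVneq x 0.
  by rewrite normr0 mulr0 norm_ge0.
have xgt0 : 0 < `|x| by rewrite normr_gt0.
rewrite -ler_pdivlMr// mulrC.
rewrite -[X in X * _]gtr0_norm ?invr_gt0// -normZ; apply: cmin.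
by rewrite inE /S /= normrZ normfV normr_id mulVf// normr_eq0.
Qed.

(** The closed ball of radius t about a for the norm N. *)
Definition nball (a : 'rV[R]_d) (t : R) : set 'rV[R]_d :=
  [set x | N (x - a) <= t].

Lemma continuous_measurable_rV (f : 'rV[R]_d -> R) :
  continuous f -> measurable_fun setT f.
Proof.
move=> cf; apply: (measurability _ (RGenOpens.measurableE R)) => _ [_ [a [b ->]] <-].
rewrite setTI; apply: sub_sigma_algebra; apply: open_comp; last exact: interval_open.
by move=> v _; exact: cf.
Qed.

Lemma lipschitz_continuous (f : 'rV[R]_d -> R) :
  (forall x y, `|f x - f y| <= N (x - y)) -> continuous f.
Proof.
have [C C0 NC] := norm_le_mxnorm => fN.
move=> x; apply/(@cvgrPdist_lt _ R^o _ (nbhs x) (nbhs_filter x)) => e e0.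
apply/(@nbhs_normP R 'rV[R]_d x); exists (e / C); first by rewrite /= divr_gt0.
move=> y /= xy; rewrite (le_lt_trans (fN _ _))// (le_lt_trans (NC _))//.
by rewrite mulrC -ltr_pdivlMr.
Qed.

Lemma measurable_normB (a : 'rV[R]_d) :
  measurable_fun setT (fun x : 'rV[R]_d => N (x - a)).
Proof.
apply: continuous_measurable_rV; apply: lipschitz_continuous => x y.
by rewrite (le_trans (normB_dist _ _))// opprB addrA subrK.
Qed.

Lemma measurable_nball a t : measurable (nball a t).
Proof.
rewrite (_ : nball a t =
  setT `&` (fun x : 'rV[R]_d => N (x - a)) @^-1` `]-oo, t]%classic).
  exact: measurable_normB.
by rewrite setTI; apply/seteqP; split => x; rewrite /nball /= in_itv.
Qed.

(** The closed ball of radius t about a for the supremum norm. *)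
Definition cube (a : 'rV[R]_d) (t : R) : set 'rV[R]_d :=
  [set v | forall i, a 0 i - t <= v 0 i <= a 0 i + t].

Lemma measurable_box (a b : 'I_d -> R) :
  measurable [set v : 'rV[R]_d | forall i, a i <= v 0 i <= b i].
Proof.
rewrite (_ : mkset _ = \bigcap_(i in [set: 'I_d]) (fun v : 'rV[R]_d => v 0 i)
    @^-1` `[a i, b i]%classic).
  apply: fin_bigcap_measurable => // i _; rewrite -[X in measurable X]setTI.
  exact: measurable_coord_rV.
by apply/seteqP; split => v /= vab i; move: (vab i); rewrite /= in_itv/=; auto.
Qed.

Lemma lebesgue_cube a t : 0 <= t ->
  lebesgue_rV R d (cube a t) = ((2 * t) ^+ d)%:E.
Proof.
move=> t0; rewrite lebesgue_rV_box; last by move=> i; lra.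
congr EFin; rewrite (eq_bigr (fun=> 2 * t)) => [|i _]; last by ring.
by rewrite prodr_const card_ord.
Qed.

Lemma cubeP a t x : 0 <= t -> cube a t x <-> `|x - a| <= t.
Proof.
move=> t0; split=> [xa|xa i].
  rewrite [leLHS]mx_normrE; apply/bigmax_leP; split=> // -[i j] _ /=.
  by rewrite !mxE ord1 ler_distl; exact: xa.
rewrite -ler_distl; apply: le_trans xa.
by rewrite [leRHS]mx_normrE (le_trans _ (le_bigmax _ _ (0, i)))//= !mxE.
Qed.

(** Volumes of N-balls are compared with those of cubes through the equivalence of
    norms, so neither homogeneity nor translation invariance is needed. *)
Lemma lebesgue_nball_le : exists2 w : R, 0 < w &
  forall a t, 0 <= t -> (lebesgue_rV R d (nball a t) <= (w * t ^+ d)%:E)%E.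
Proof.
have [c c0 cN] := mxnorm_le_norm.
exists ((2 / c) ^+ d) => [|a t t0]; first by rewrite exprn_gt0// divr_gt0.
rewrite -exprMn -mulrA [c^-1 * t]mulrC -(lebesgue_cube a); last first.
  by rewrite divr_ge0// ltW.
apply: le_measure; rewrite ?inE; [exact: measurable_nball|exact: measurable_box|].
move=> x xa; apply/cubeP; first by rewrite divr_ge0// ltW.
by rewrite ler_pdivlMr// mulrC (le_trans (cN _)).
Qed.

Lemma lebesgue_nball_ge : exists2 w : R, 0 < w &
  forall a t, 0 <= t -> ((w * t ^+ d)%:E <= lebesgue_rV R d (nball a t))%E.
Proof.
have [c c0 Nc] := norm_le_mxnorm.
exists ((2 / c) ^+ d) => [|a t t0]; first by rewrite exprn_gt0// divr_gt0.
have tc : 0 <= t / c by rewrite divr_ge0// ltW.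
rewrite -exprMn -mulrA [c^-1 * t]mulrC -(lebesgue_cube a)//.
apply: le_measure; rewrite ?inE; [exact: measurable_box|exact: measurable_nball|].
move=> x /cubeP-/(_ tc) xa; rewrite /nball /= (le_trans (Nc _))//.
by rewrite mulrC -ler_pdivlMr.
Qed.

End norm.

(** * Distance to a finite codebook and its distortion *)

Section codebook_distance.
Context (R : realType) (d : nat) (N : 'rV[R]_d -> R) (hN : is_norm N).
Implicit Types (s : seq 'rV[R]_d) (x y a b : 'rV[R]_d).

(** The distance from x to the codebook listed by s, as a real number; it is 0 for
    the empty list, whereas [dist] is then +oo. *)
Definition qdist s x : R := fine (dist N x [set` s]).

Lemma nearest s x : s != [::] ->
  exists2 a, a \in s & forall b, b \in s -> N (x - a) <= N (x - b).
Proof.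
elim: s => // a s ih _; have [->|/ih[b bs bmin]] := eqVneq s [::].
  by exists a; rewrite ?mem_head// => b; rewrite inE => /eqP ->.
have [ab|ba] := leP (N (x - a)) (N (x - b)).
  exists a => [|c]; first exact: mem_head.
  by rewrite inE => /predU1P[->//|/bmin]; exact: le_trans.
exists b => [|c]; first by rewrite inE bs orbT.
by rewrite inE => /predU1P[->|/bmin//]; exact: ltW.
Qed.

Lemma dist_nearest s x a : a \in s ->
  (forall b, b \in s -> N (x - a) <= N (x - b)) ->
  dist N x [set` s] = (N (x - a))%:E.
Proof.
move=> sa amin; apply/eqP; rewrite eq_le; apply/andP; split.
  by apply: ereal_inf_lbound; exists a.
by apply: le_ereal_inf_tmp => _ [b sb <-]; rewrite lee_fin amin.
Qed.

Lemma dist_qdist s x : s != [::] -> dist N x [set` s] = (qdist s x)%:E.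
Proof. by move=> /(nearest x)[a sa /(dist_nearest sa)]; rewrite /qdist => ->. Qed.

Lemma qdist_le s x a : a \in s -> qdist s x <= N (x - a).
Proof.
move=> sa; rewrite -lee_fin -dist_qdist.
  by apply: ereal_inf_lbound; exists a.
by apply: contraTneq sa => ->.
Qed.

Lemma qdist_attained s x : s != [::] ->
  exists2 a, a \in s & qdist s x = N (x - a).
Proof.
move=> /(nearest x)[a sa amin]; exists a => //.
by rewrite /qdist (dist_nearest sa).
Qed.

Lemma qdist_nil x : qdist [::] x = 0.
Proof.
rewrite /qdist /dist.
have -> : [set` [::]] = set0 :> set 'rV[R]_d by apply/seteqP; split.
by rewrite image_set0 ereal_inf0.
Qed.

Lemma qdist_ge0 s x : 0 <= qdist s x.
Proof.
have [->|/(qdist_attained x)[a _ ->]] := eqVneq s [::]; last exact: norm_ge0.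
by rewrite qdist_nil.
Qed.

Lemma qdist_leD s x y : qdist s x <= qdist s y + N (x - y).
Proof.
have [->|/(qdist_attained y)[a sa ->]] := eqVneq s [::].
  by rewrite !qdist_nil add0r norm_ge0.
by rewrite (le_trans (qdist_le _ sa))// [leRHS]addrC; exact: normBD.
Qed.

Lemma le_qdist s1 s2 x : s1 != [::] -> {subset s1 <= s2} ->
  qdist s2 x <= qdist s1 x.
Proof. by move=> /(qdist_attained x)[a sa ->] s12; exact/qdist_le/s12. Qed.

Lemma measurable_qdist s : measurable_fun setT (qdist s).
Proof.
apply: continuous_measurable_rV; apply: (lipschitz_continuous hN) => x y.
rewrite ler_distl qdist_leD//= andbT lerBlDr.
by rewrite (normBC hN) qdist_leD.
Qed.

End codebook_distance.

Section power_inequalities.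
Context {R : realType}.
Implicit Types x y r : R.

Lemma powR_add_le r x y : 0 <= r -> 0 <= x -> 0 <= y ->
  (x + y) `^ r <= 2 `^ r * (x `^ r + y `^ r).
Proof.
move=> r0; wlog : x y / x <= y => [H x0 y0|xy x0 y0].
  have [/H|/ltW/H] := leP x y; first exact.
  by rewrite (addrC y x) (addrC (y `^ r)); exact.
apply: (@le_trans _ _ ((2 * y) `^ r)).
  by apply: ge0_ler_powR; rewrite ?nnegrE; lra.
by rewrite powRM// ler_wpM2l ?powR_ge0// lerDr powR_ge0.
Qed.

Lemma powR_le_powRD r x y : 0 <= r -> 0 <= y -> 0 <= x ->
  x `^ r <= 1 + x `^ (r + y).
Proof.
move=> r0 y0 x0; have [x1|/ltW x1] := leP x 1.
  rewrite ler_wpDr ?powR_ge0//.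
  have -> : 1 = 1 `^ r :> R by rewrite powR1.
  by apply: ge0_ler_powR; rewrite ?nnegrE.
by rewrite ler_wpDl// ler_powR// lerDl.
Qed.

End power_inequalities.

Section distortion_real.
Context (R : realType) (d : nat) (N : 'rV[R]_d -> R) (hN : is_norm N).
Context (r : R) (hr : 0 < r) (P : probability 'rV[R]_d R).
Implicit Types (s : seq 'rV[R]_d) (x y a b : 'rV[R]_d) (f g : 'rV[R]_d -> R).

Local Notation I f := (\int[P]_x (f x)%:E)%E.

Lemma int_le f g : measurable_fun setT f -> measurable_fun setT g ->
  (forall x, 0 <= f x) -> (forall x, f x <= g x) -> (I f <= I g)%E.
Proof.
move=> mf mg f0 fg; apply: ge0_le_integral => //.
- by move=> x _; rewrite lee_fin.
- exact/measurable_EFinP.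
- exact/measurable_EFinP.
- by move=> x _; rewrite lee_fin.
Qed.

Lemma intD f g : measurable_fun setT f -> measurable_fun setT g ->
  (forall x, 0 <= f x) -> (forall x, 0 <= g x) ->
  (\int[P]_x (f x + g x)%:E = I f + I g)%E.
Proof.
move=> mf mg f0 g0; under eq_integral do rewrite EFinD.
rewrite ge0_integralD//.
- by move=> x _; rewrite lee_fin.
- exact/measurable_EFinP.
- by move=> x _; rewrite lee_fin.
- exact/measurable_EFinP.
Qed.

Lemma intZ f c : measurable_fun setT f -> (forall x, 0 <= f x) -> 0 <= c ->
  (\int[P]_x (c * f x)%:E = c%:E * I f)%E.
Proof.
move=> mf f0 c0; under eq_integral do rewrite EFinM.
rewrite ge0_integralZl//.
- exact/measurable_EFinP.
- by move=> x _; rewrite lee_fin.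
Qed.

Lemma int_cst c : (\int[P]_x c%:E = c%:E)%E.
Proof.
rewrite integral_cst// -[RHS]mule1; congr (_ * _)%E; exact: probability_setT.
Qed.

Lemma int_indic A c : measurable A -> 0 <= c ->
  (\int[P]_x (c * \1_A x)%:E = c%:E * P A)%E.
Proof.
move=> mA c0; rewrite intZ; last 3 first.
- exact: measurable_indic.
- by move=> x; rewrite indicE ler0n.
- exact: c0.
by rewrite integral_indic// setIT.
Qed.

Fact err_key : unit. Proof. exact: tt. Qed.

(** The distortion of the codebook listed by s, as a real number, with value 0
    on the empty list.  It is locked so that unification never unfolds the
    integral. *)
Definition err s : R :=
  locked_with err_key (fine (\int[P]_x (qdist N s x `^ r)%:E)%E).

Lemma measurable_qdist_powR s : measurable_fun setT (fun x => qdist N s x `^ r).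
Proof. exact: measurableT_comp (measurable_powR r) (measurable_qdist hN s). Qed.

Context (moment : (\int[P]_x (N x `^ r)%:E < +oo)%E).

(** The moment of order r makes the distortion of every finite codebook finite. *)
Lemma errE s : (\int[P]_x (qdist N s x `^ r)%:E = (err s)%:E)%E.
Proof.
rewrite /err unlock fineK// ge0_fin_numE; last first.
  by apply: integral_ge0 => x _; rewrite lee_fin powR_ge0.
have mN : measurable_fun setT (fun x => N x `^ r).
  apply: measurableT_comp (measurable_powR r) _.
  by apply: continuous_measurable_rV; exact: is_norm_continuous.
have [->|] := eqVneq s [::].
  under eq_integral do rewrite qdist_nil powR0 ?gt_eqF//.
  by rewrite integral0.
case: s => // a s _.
apply: (@le_lt_trans _ _ (\int[P]_x (2 `^ r * (N x `^ r + N a `^ r))%:E)%E).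
  apply: int_le => [|||x].
  - exact: measurable_qdist_powR.
  - by apply: measurable_funM => //; apply: measurable_funD.
  - by move=> x; exact: powR_ge0.
  apply: le_trans (powR_add_le (ltW hr) (norm_ge0 hN x) (norm_ge0 hN a)).
  apply: (ge0_ler_powR (ltW hr)); rewrite ?nnegrE ?qdist_ge0 ?addr_ge0 ?norm_ge0//.
  rewrite (le_trans (qdist_le N _ (mem_head _ _)))//.
  by rewrite (le_trans (normD hN _ _))// (normN hN).
rewrite intZ ?intD ?int_cst ?powR_ge0//; last 3 first.
- by move=> x; rewrite powR_ge0.
- by apply: measurable_funD.
- by move=> x; rewrite addr_ge0 ?powR_ge0.
by rewrite lte_mul_pinfty ?lee_fin ?powR_ge0// lte_add_pinfty// ltry.
Qed.

Lemma distortion_err s : s != [::] -> distortion N r P [set` s] = (err s)%:E.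
Proof.
by move=> s0; rewrite -errE; apply: eq_integral => x _; rewrite dist_qdist.
Qed.

Lemma distortion_set0 : distortion N r P set0 = +oo%E.
Proof.
rewrite /distortion; under eq_integral do
  rewrite /dist image_set0 ereal_inf0 poweRyr ?gt_eqF//.
rewrite integral_cst//; transitivity (+oo * 1 : \bar R)%E; last by rewrite mule1.
by congr (_ * _)%E; exact: probability_setT.
Qed.

Lemma fine_prob A : measurable A -> (fine (P A))%:E = P A.
Proof.
by move=> mA; rewrite fineK// fin_num_measure.
Qed.

Lemma measurable_err_indic s A c : measurable A ->
  measurable_fun setT (fun x => qdist N s x `^ r + c * \1_A x).
Proof.
move=> mA; apply: measurable_funD; first exact: measurable_qdist_powR.
by apply: measurable_funM => //; exact: measurable_indic.
Qed.

Lemma int_err_indic s A c : measurable A -> 0 <= c ->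
  (\int[P]_x (qdist N s x `^ r + c * \1_A x)%:E =
   (err s + c * fine (P A))%:E)%E.
Proof.
move=> mA c0; rewrite intD; last 4 first.
- exact: measurable_qdist_powR.
- by apply: measurable_funM => //; exact: measurable_indic.
- by move=> x; exact: powR_ge0.
- by move=> x; rewrite mulr_ge0// indicE ler0n.
by rewrite errE (int_indic mA c0) -(fine_prob mA).
Qed.

Lemma err_indic_le s1 s2 A c : measurable A -> 0 <= c ->
  (forall x, qdist N s1 x `^ r <= qdist N s2 x `^ r + c * \1_A x) ->
  err s1 <= err s2 + c * fine (P A).
Proof.
move=> mA c0 H; have := int_err_indic s2 mA c0 => E.
have : ((err s1)%:E <= (err s2 + c * fine (P A))%:E)%E.
  rewrite -E -errE; apply: int_le; last exact: H.
  - exact: measurable_qdist_powR.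
  - exact: measurable_err_indic.
  - by move=> x; exact: powR_ge0.
by rewrite lee_fin.
Qed.

Lemma err_indic_ge s1 s2 A c : measurable A -> 0 <= c ->
  (forall x, qdist N s1 x `^ r + c * \1_A x <= qdist N s2 x `^ r) ->
  err s1 + c * fine (P A) <= err s2.
Proof.
move=> mA c0 H; have := int_err_indic s1 mA c0 => E.
have : ((err s1 + c * fine (P A))%:E <= (err s2)%:E)%E.
  rewrite -E -errE; apply: int_le; last exact: H.
  - exact: measurable_err_indic.
  - exact: measurable_qdist_powR.
  - by move=> x; rewrite addr_ge0 ?powR_ge0// mulr_ge0// indicE ler0n.
by rewrite lee_fin.
Qed.

(** Adding to s a point y at distance at least t from s: on the ball of radius t/4
    about y the distance drops from at least 3t/4 to at most t/4. *)
Lemma err_gain s y t : s != [::] -> 0 <= t <= qdist N s y ->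
  err (y :: s) +
    ((3 / 4) `^ r - 4^-1 `^ r) * t `^ r * fine (P (nball N y (t / 4)))
  <= err s.
Proof.
move=> s0 /andP[t0 ty].
have c0 : 0 <= (3 / 4) `^ r - 4^-1 `^ r :> R.
  rewrite subr_ge0; apply: (ge0_ler_powR (ltW hr)); rewrite ?nnegrE; lra.
apply: err_indic_ge.
- exact: measurable_nball.
- by rewrite mulr_ge0 ?powR_ge0.
move=> x; rewrite indicE.
case: (boolP (x \in nball N y (t / 4))) => [/set_mem|_]; last first.
  rewrite mulr0 addr0; apply: (ge0_ler_powR (ltW hr)); rewrite ?nnegrE ?qdist_ge0//.
  by rewrite le_qdist// => a sa; rewrite inE sa orbT.
rewrite /nball /= mulr1 => xy.
have H1 : qdist N (y :: s) x `^ r <= 4^-1 `^ r * t `^ r.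
  rewrite -powRM//; apply: (ge0_ler_powR (ltW hr)); rewrite ?nnegrE ?qdist_ge0//.
    by rewrite mulr_ge0.
  by rewrite (le_trans (qdist_le N _ (mem_head _ _)))// mulrC.
have H2 : (3 / 4) `^ r * t `^ r <= qdist N s x `^ r.
  rewrite -powRM//; apply: (ge0_ler_powR (ltW hr)); rewrite ?nnegrE ?qdist_ge0//.
    by rewrite mulr_ge0.
  have := qdist_leD hN s y x; rewrite (normBC hN); lra.
rewrite mulrBl; lra.
Qed.

End distortion_real.

(** * The Pierce bound on optimal distortions *)

Section tau.
Context (R : realType) (d : nat) (hd : (0 < d)%N).

Fact tau_key : unit. Proof. exact: tt. Qed.

(** The length scale n^(-1/d), locked so that unification never unfolds the real
    power. *)
Definition tau (n : nat) : R := locked_with tau_key (n%:R `^ (- d%:R^-1)).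

Lemma tauE n : tau n = n%:R `^ (- d%:R^-1). Proof. by rewrite /tau unlock. Qed.

Lemma tau_gt0 n : (0 < n)%N -> 0 < tau n.
Proof. by move=> n0; rewrite tauE powR_gt0// ltr0n. Qed.

Lemma tauX n : tau n ^+ d = n%:R^-1.
Proof.
rewrite tauE -powR_mulrn ?powR_ge0// -powRrM mulNr mulVf ?pnatr_eq0 -?lt0n//.
by rewrite powR_inv1.
Qed.

Lemma tau_le m n : (0 < m <= n)%N -> tau n <= tau m.
Proof.
move=> /andP[m0 mn]; rewrite !tauE !powRN lef_pV2 ?posrE ?powR_gt0 ?ltr0n//.
  by apply: ge0_ler_powR; rewrite ?nnegrE ?ler_nat// invr_ge0.
exact: leq_trans mn.
Qed.

Lemma tau_small e : 0 < e -> exists n0, forall n, (n0 <= n)%N -> tau n <= e.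
Proof.
move=> e0; exists (Num.truncn (e ^- d)).+1 => n hn.
have n0 : (0 < n)%N by exact: leq_trans hn.
rewrite -(@ler_pXn2r _ d)// ?nnegrE ?(ltW e0) ?(ltW (tau_gt0 _))// tauX.
rewrite -[leRHS]invrK lef_pV2 ?posrE ?invr_gt0 ?exprn_gt0 ?ltr0n//.
have /andP[_ /ltW h] : (Num.truncn (e ^- d))%:R <= e ^- d < (Num.truncn (e ^- d)).+1%:R.
  by apply: truncn_itv; rewrite invr_ge0 exprn_ge0// ltW.
by rewrite (le_trans h)// ler_nat.
Qed.

(** The normalisation of the local inertia: n^(1 + r/d) = 1 / (tau(n)^r / n). *)
Lemma tau_powR r n : (0 < n)%N ->
  n%:R `^ (1 + r / d%:R) * (tau n `^ r / n%:R) = 1.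
Proof.
move=> n0; rewrite tauE -powRrM mulNr [d%:R^-1 * r]mulrC.
rewrite powRD ?pnatr_eq0 -?lt0n ?n0 ?implybT// powRr1// powRN.
have h : n%:R `^ (r / d%:R) != 0 :> R by rewrite gt_eqF// powR_gt0// ltr0n.
have h' : n%:R != 0 :> R by rewrite pnatr_eq0 -lt0n.
by field; rewrite h h'.
Qed.

End tau.

Section pierce.
Context {R : realType}.

Lemma subX_le (p : nat) (s z : R) : 0 <= z -> z <= s ->
  s ^+ p.+1 - z ^+ p.+1 <= p.+1%:R * s ^+ p * (s - z).
Proof.
move=> z0 zs; have s0 : 0 <= s by exact: le_trans zs.
have sz : 0 <= s - z by rewrite subr_ge0.
elim: p => [|p ih]; first by rewrite !expr1 expr0; lra.
have h : z ^+ p.+1 * (s - z) <= s ^+ p.+1 * (s - z).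
  by rewrite ler_wpM2r// lerXn2r ?nnegrE.
have := ler_wpM2l s0 ih.
rewrite [s ^+ p.+2]exprS [z ^+ p.+2]exprS -[in X in _ -> X]natr1.
move: h; rewrite !mulrA [s * p.+1%:R]mulrC -[p.+1%:R * s * _]mulrA -exprS.
set A := s ^+ p.+1; set B := z ^+ p.+1; lra.
Qed.

(** The reals +-((m/k)^(p+1) - 1) for k = 1, ..., m + 1, which discretise a law with
    polynomial tails; the boolean is the sign. *)
Definition pareto_point (m p : nat) (bj : bool * 'I_m.+1) : R :=
  (-1) ^+ bj.1 * ((m%:R / bj.2.+1%:R) ^+ p.+1 - 1).

(** With s = (1 + |x|)^(1/(p+1)) and k the integer part of m/s plus one, the gap
    between s^(p+1) = 1 + |x| and (m/k)^(p+1) is at most (p+1) * s^p * (s - m/k),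
    and s - m/k <= s^2 / m. *)
Lemma pareto_point_near (m p : nat) (x : R) : (0 < m)%N ->
  exists bj : bool * 'I_m.+1, `|x - pareto_point p bj| <=
    p.+1%:R / m%:R * ((1 + `|x|) * (1 + `|x|) `^ p.+1%:R^-1).
Proof.
move=> m0; have m0' : 0 < m%:R :> R by rewrite ltr0n.
suff H : forall x : R, 0 <= x -> exists j : 'I_m.+1,
    `|x - ((m%:R / j.+1%:R) ^+ p.+1 - 1)| <=
    p.+1%:R / m%:R * ((1 + x) * (1 + x) `^ p.+1%:R^-1).
  have [j hj] := H `|x| (normr_ge0 x); exists (x < 0, j).
  by rewrite /pareto_point /= {1}[x]numEsign -mulrBr normrM normr_sign mul1r.
move=> {}x x0.
pose s := (1 + x) `^ p.+1%:R^-1.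
have s1 : 1 <= s.
  rewrite -[leLHS](powRr0 (1 + x)) ler_powR// lerDl//.
have s0 : 0 < s by exact: lt_le_trans s1.
have sE : s ^+ p.+1 = 1 + x.
  rewrite -powR_mulrn ?(ltW s0)// -powRrM mulVf ?pnatr_eq0// powRr1//.
  by rewrite addr_ge0.
pose u := m%:R / s.
have u0 : 0 <= u by rewrite divr_ge0// ltW.
have /andP[tu ut] := truncn_itv u0.
have um : (Num.truncn u < m.+1)%N.
  rewrite truncn_lt_nat// (@le_lt_trans _ _ m%:R) ?ltr_nat//.
  by rewrite ler_pdivrMr// ler_peMr// ltW.
exists (Ordinal um) => /=.
set k := (Num.truncn u).+1%:R in ut *.
have k0 : 0 < k by rewrite ltr0n.
have ku : k <= u + 1 by rewrite /k -natr1 lerD2r.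
set z := m%:R / k.
have z0 : 0 <= z by rewrite divr_ge0// ltW.
have uE : u * s = m%:R by rewrite /u divfK// gt_eqF.
have zE : z * k = m%:R by rewrite /z divfK// gt_eqF.
have zs : z <= s.
  rewrite /z ler_pdivrMr// -uE mulrC ler_wpM2l ?ltW//.
have szm : (s - z) * m%:R <= s ^+ 2.
  rewrite -(ler_pM2r k0).
  have -> : (s - z) * m%:R * k = (s * k - m%:R) * m%:R by rewrite -zE; ring.
  have : s * k - m%:R <= s.
    by rewrite -uE; have := ler_wpM2l (ltW s0) ku; lra.
  move=> /(ler_wpM2r (ltW m0')) /le_trans; apply.
  rewrite expr2 -mulrA (ler_wpM2l (ltW s0))//.
  by rewrite -uE mulrC (ler_wpM2l (ltW s0))// ltW.
have zsp : z ^+ p.+1 <= s ^+ p.+1 by apply: lerXn2r; rewrite ?nnegrE ?(ltW s0).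
rewrite opprB addrA [x + 1]addrC -/s -sE ger0_norm ?subr_ge0//.
apply: (le_trans (subX_le p z0 zs)).
rewrite -!mulrA ler_wpM2l// -/s mulrC.
rewrite -(ler_pM2r m0').
have -> : m%:R^-1 * (s ^+ p.+1 * s) * m%:R = s ^+ p * s ^+ 2.
  by rewrite exprS; field; rewrite gt_eqF.
by rewrite mulrAC mulrC ler_wpM2l// exprn_ge0// ltW.
Qed.

(** All row vectors whose coordinates are [pareto_point]s. *)
Definition pareto_codebook (d m p : nat) : seq 'rV[R]_d :=
  [seq \row_i pareto_point p (f i) | f : {ffun 'I_d -> bool * 'I_m.+1}].

Lemma size_pareto_codebook d m p :
  size (pareto_codebook d m p) = ((2 * m.+1) ^ d)%N.
Proof. by rewrite size_map -cardE card_ffun card_prod card_bool !card_ord. Qed.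

Lemma pareto_codebook_near (d m p : nat) (x : 'rV[R]_d) : (0 < m)%N ->
  exists2 a, a \in pareto_codebook d m p & `|x - a| <=
    p.+1%:R / m%:R * ((1 + `|x|) * (1 + `|x|) `^ p.+1%:R^-1).
Proof.
move=> m0; pose f := [ffun i => sval (cid (pareto_point_near p (x 0 i) m0))].
exists (\row_i pareto_point p (f i)); first by apply/mapP; exists f; rewrite ?mem_enum.
rewrite [leLHS]mx_normrE; apply/bigmax_leP; split=> [|[i j] _ /=].
  by rewrite !mulr_ge0 ?invr_ge0 ?ler0n ?powR_ge0.
rewrite !mxE ord1 ffunE; case: cid => /= bj /le_trans; apply.
rewrite ler_wpM2l ?mulr_ge0 ?invr_ge0//.
have xj : `|x 0 j| <= `|x|.
  by rewrite [leRHS]mx_normrE (le_bigmax _ _ (0, j)).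
apply: ler_pM; rewrite ?powR_ge0 ?lerD2l//.
by apply: ge0_ler_powR; rewrite ?nnegrE ?lerD2l ?addr_ge0.
Qed.

End pierce.

Section pierce_error.
Context (R : realType) (d : nat) (hd : (0 < d)%N).
Context (N : 'rV[R]_d -> R) (hN : is_norm N).
Context (r : R) (hr : 0 < r) (P : probability 'rV[R]_d R).
Context (delta : R) (delta0 : 0 < delta).
Context (hmoment : (\int[P]_x (N x `^ (r + delta))%:E < +oo)%E).

Lemma measurable_norm_powR (q : R) : measurable_fun setT (fun x => N x `^ q).
Proof.
apply: measurableT_comp (measurable_powR q) _.
by apply: continuous_measurable_rV; exact: is_norm_continuous.
Qed.

Lemma finite_moment : (\int[P]_x (N x `^ r)%:E < +oo)%E.
Proof.
apply: (@le_lt_trans _ _ (\int[P]_x (1 + N x `^ (r + delta))%:E)%E).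
  apply: int_le => [|||x].
  - exact: measurable_norm_powR.
  - by apply: measurable_funD => //; exact: measurable_norm_powR.
  - by move=> x; exact: powR_ge0.
  by apply: powR_le_powRD; [exact: ltW|exact: ltW|exact: norm_ge0].
rewrite intD ?int_cst//; last 2 first.
- exact: measurable_norm_powR.
- by move=> x; exact: powR_ge0.
by rewrite lte_add_pinfty// ltry.
Qed.

(** The exponent p is chosen with r/(p+1) <= delta, so that the (1 + 1/(p+1))-th
    power of the norm, raised to r, is controlled by the moment of order r + delta. *)
Lemma pareto_codebook_qdist : exists p : nat, exists2 C : R, 0 < C &
  forall (m : nat) x, (0 < m)%N -> qdist N (pareto_codebook d m p) x `^ r <=
    C * m%:R `^ (- r) * (1 + N x `^ (r + delta)).
Proof.
have [c c0 cN] := mxnorm_le_norm hN.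
have [K K0 NK] := norm_le_mxnorm hN.
pose p := Num.truncn (r / delta); exists p.
have rp : r * p.+1%:R^-1 <= delta.
  have /andP[_ /ltW] : p%:R <= r / delta < p.+1%:R.
    by apply: truncn_itv; rewrite divr_ge0// ltW.
  by rewrite ler_pdivrMr// ler_pdivrMr ?ltr0n// mulrC.
pose b := 1 + c^-1.
have c'0 : 0 < c^-1 by rewrite invr_gt0.
have b1 : 1 <= b by rewrite /b lerDl ltW.
have b0 : 0 < b by exact: lt_le_trans b1.
have [B B0 BE] : exists2 B, 0 < B & B = K * p.+1%:R.
  by exists (K * p.+1%:R) => //; rewrite mulr_gt0 ?ltr0n.
exists (B `^ r * (b `^ (r + delta) * 2 `^ (r + delta))).
  by rewrite !mulr_gt0 ?powR_gt0.
move=> m x m0; have m0' : 0 < m%:R :> R by rewrite ltr0n.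
have [a sa xa] := pareto_codebook_near p x m0.
have Nx0 := norm_ge0 hN x.
set y := 1 + `|x| in xa.
have y1 : 1 <= y by rewrite /y lerDl.
have y0 : 0 < y by exact: lt_le_trans y1.
have q1 : qdist N (pareto_codebook d m p) x <= B / m%:R * (y * y `^ p.+1%:R^-1).
  rewrite (le_trans (qdist_le N x sa))// (le_trans (NK _))//.
  by rewrite BE -!mulrA (ler_wpM2l (ltW K0))// mulrA.
apply: (@le_trans _ _ ((B / m%:R * (y * y `^ p.+1%:R^-1)) `^ r)).
  apply: (ge0_ler_powR (ltW hr)); rewrite ?nnegrE ?qdist_ge0//.
  by rewrite !mulr_ge0 ?powR_ge0 ?invr_ge0// ltW.
rewrite !powRM ?mulr_ge0 ?powR_ge0 ?invr_ge0 ?(ltW m0') ?(ltW B0) ?(ltW y0)//.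
have -> : m%:R^-1 `^ r = m%:R `^ (- r) :> R.
  by rewrite -powR_inv1 ?(ltW m0')// -powRrM mulN1r.
rewrite -!mulrA ler_wpM2l ?powR_ge0// [leRHS]mulrCA [leRHS]mulrA.
rewrite [X in _ <= X](_ : _ = m%:R `^ (- r) *
  (b `^ (r + delta) * (2 `^ (r + delta) * (1 + N x `^ (r + delta)))))//; last first.
  by ring.
rewrite ler_wpM2l ?powR_ge0//.
apply: (@le_trans _ _ (y `^ (r + delta))).
  rewrite -powRrM -powRD; last by rewrite (gt_eqF y0) implybT.
  by rewrite ler_powR// lerD2l mulrC.
have rd0 : 0 <= r + delta by rewrite addr_ge0// ltW.
apply: (@le_trans _ _ ((b * (1 + N x)) `^ (r + delta))).
  apply: (ge0_ler_powR rd0); rewrite ?nnegrE ?(ltW y0) ?mulr_ge0 ?(ltW b0) ?addr_ge0//.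
  have : `|x| <= c^-1 * N x by rewrite mulrC ler_pdivlMr// mulrC.
  rewrite /y /b; have := mulr_ge0 (ltW c'0) Nx0; lra.
rewrite (@powRM _ b (1 + N x)) ?(ltW b0) ?addr_ge0//.
apply: ler_wpM2l; first exact: powR_ge0.
by rewrite (le_trans (powR_add_le _ _ _))// powR1.
Qed.

(** The Pierce bound: codebooks with at most n points have distortion of order at
    most n^(-r/d). *)
Lemma pierce : exists2 C : R, 0 < C & exists n0 : nat, forall n, (n0 <= n)%N ->
  exists s : seq 'rV[R]_d,
    [/\ s != [::], (size s <= n)%N & err N r P s <= C * tau R d n `^ r].
Proof.
have [p [C C0 HC]] := pareto_codebook_qdist.
have fm := finite_moment.
have MF : (\int[P]_x (N x `^ (r + delta))%:E)%E \is a fin_num.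
  by rewrite ge0_fin_numE// integral_ge0// => x _; rewrite lee_fin powR_ge0.
pose M := fine (\int[P]_x (N x `^ (r + delta))%:E)%E.
have M0 : 0 <= M by rewrite fine_ge0// integral_ge0// => x _; rewrite lee_fin powR_ge0.
have errC (m : nat) : (0 < m)%N ->
    err N r P (pareto_codebook d m p) <= C * m%:R `^ (- r) * (1 + M).
  move=> m0; set s := pareto_codebook _ _ _.
  have : ((err N r P s)%:E <= (C * m%:R `^ (- r) * (1 + M))%:E)%E.
    have -> : ((C * m%:R `^ (- r) * (1 + M))%:E =
        \int[P]_x (C * m%:R `^ (- r) * (1 + N x `^ (r + delta)))%:E)%E.
      rewrite intZ; last 3 first.
      - by apply: measurable_funD => //; exact: measurable_norm_powR.
      - by move=> x; rewrite addr_ge0 ?powR_ge0.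
      - by rewrite mulr_ge0 ?powR_ge0 ?(ltW C0).
      rewrite intD ?int_cst//; last 2 first.
      - exact: measurable_norm_powR.
      - by move=> x; exact: powR_ge0.
      by rewrite EFinM EFinD /M fineK.
    rewrite -(errE hN hr fm); apply: int_le => [|||x].
    - exact: measurable_qdist_powR.
    - apply: measurable_funM => //.
      by apply: measurable_funD => //; exact: measurable_norm_powR.
    - by move=> x; exact: powR_ge0.
    exact: HC.
  by rewrite lee_fin.
exists (C * 8 `^ r * (1 + M)).
  by rewrite !mulr_gt0 ?powR_gt0// ltr_pwDl.
(* For n >= 4^d the grid with m = floor(n^(1/d) / 4) fits, as 2 * (m + 1) <= 4 * m. *)
exists (4 ^ d)%N => n hn.
have n0 : (0 < n)%N by rewrite (leq_trans _ hn)// expn_gt0.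
pose v := (tau R d n)^-1.
have t0 := tau_gt0 R d n0.
have v0 : 0 < v by rewrite invr_gt0.
have vd : v ^+ d = n%:R by rewrite exprVn tauX// invrK.
have v4 : 4 <= v.
  rewrite -(@ler_pXn2r _ d)// ?nnegrE ?(ltW v0)// vd.
  by rewrite -natrX ler_nat.
pose m := Num.truncn (v / 4).
have /andP[mv vm] : m%:R <= v / 4 < m.+1%:R.
  by apply: truncn_itv; rewrite divr_ge0// ltW.
have m0 : (0 < m)%N.
  by rewrite /m truncn_gt0 ler_pdivlMr// mul1r.
have m1 : 1 <= m%:R :> R by rewrite ler1n.
exists (pareto_codebook d m p); split.
- by rewrite -size_eq0 size_pareto_codebook expn_eq0.
- rewrite size_pareto_codebook -(ler_nat R) -vd natrX natrM.
  rewrite lerXn2r ?nnegrE ?(ltW v0) ?mulr_ge0//.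
  by rewrite -natr1; lra.
rewrite (le_trans (errC m m0))// [leRHS]mulrAC.
rewrite ler_wpM2r ?addr_ge0// -!mulrA ler_wpM2l ?(ltW C0)//.
have m8 : v / 8 <= m%:R by have := vm; rewrite -[m.+1%:R]natr1 => vm'; lra.
rewrite -powRM ?(ltW t0)// powRN -[leRHS]invrK.
have h8 : 0 < 8 * tau R d n by rewrite mulr_gt0.
rewrite lef_pV2 ?posrE ?invr_gt0 ?powR_gt0 ?ltr0n//.
rewrite -powRN -mulN1r powRrM powR_inv1 ?(ltW h8)//.
apply: (ge0_ler_powR (ltW hr)); rewrite ?nnegrE ?invr_ge0 ?(ltW h8)//.
by rewrite invfM mulrC.
Qed.

End pierce_error.

(** * Grids, densities and coverings *)

Lemma measure_bigsetU_le d (T : measurableType d) (R : realType)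
    (mu : {measure set T -> \bar R}) (I : Type) (s : seq I) (F : I -> set T) :
  (forall i, measurable (F i)) ->
  (mu (\big[setU/set0]_(i <- s) F i) <= \sum_(i <- s) mu (F i))%E.
Proof.
move=> mF; elim: s => [|i s ih]; first by rewrite !big_nil measure0.
rewrite !big_cons (le_trans (measureU2 _ _ _))//.
  by apply: bigsetU_measurable => j _; exact: mF.
by rewrite leeD2l.
Qed.

Section grid.
Context (R : realType) (d : nat) (hd : (0 < d)%N).
Context (N : 'rV[R]_d -> R) (hN : is_norm N).

(** A ball is covered by at most Q / t^d measurable sets of N-diameter at most t,
    namely the boxes of a grid. *)
Lemma grid_cover (L : R) : 0 < L -> exists2 Q : R, 0 < Q &
  forall t, 0 < t <= 1 -> exists (I : finType) (F : I -> set 'rV[R]_d),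
    [/\ forall i, measurable (F i), #|I|%:R <= Q / t ^+ d,
        forall x, N x <= L -> exists i, F i x &
        forall i x y, F i x -> F i y -> N (x - y) <= t].
Proof.
move=> L0.
have [c c0 cN] := mxnorm_le_norm hN.
have [K K0 NK] := norm_le_mxnorm hN.
have [M M0 ME] : exists2 M, 0 < M & M = L / c by exists (L / c) => //; rewrite divr_gt0.
exists ((2 * M * K + 1) ^+ d).
  by rewrite exprn_gt0// ltr_wpDl// !mulr_ge0 ?(ltW M0) ?(ltW K0).
move=> t /andP[t0 t1].
pose eta := t / K; have eta0 : 0 < eta by rewrite divr_gt0.
pose m := Num.truncn (2 * M / eta).
have /andP[mM _] : m%:R <= 2 * M / eta < m.+1%:R.
  by apply: truncn_itv; rewrite !mulr_ge0 ?invr_ge0 ?(ltW M0) ?(ltW eta0).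
exists ({ffun 'I_d -> 'I_m.+1} : finType).
pose lo (f : {ffun 'I_d -> 'I_m.+1}) i : R := eta * (f i)%:R - M.
exists (fun f => [set v : 'rV[R]_d | forall i, lo f i <= v 0 i <= lo f i + eta]).
split.
- by move=> f; exact: measurable_box.
- rewrite card_ffun !card_ord natrX -expr_div_n.
  apply: lerXn2r; rewrite ?nnegrE//.
    by rewrite divr_ge0 ?(ltW t0)// addr_ge0// !mulr_ge0 ?(ltW M0) ?(ltW K0).
  rewrite -natr1 mulrDl lerD//; last by rewrite div1r invf_ge1.
  rewrite (le_trans mM)// /eta invf_div mulrA.
  by [].
- move=> x xL.
  have xM i : `|x 0 i| <= M.
    rewrite (@le_trans _ _ `|x|)//.
      by rewrite [leRHS]mx_normrE (le_bigmax _ _ (0, i)).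
    by rewrite ME ler_pdivlMr// mulrC (le_trans (cN _)).
  pose u i := (x 0 i + M) / eta.
  have u0 i : 0 <= u i.
    rewrite divr_ge0 ?(ltW eta0)//; have := xM i; rewrite ler_norml; lra.
  have um i : (Num.truncn (u i) < m.+1)%N.
    rewrite ltnS le_truncn// ler_wpM2r ?invr_ge0 ?(ltW eta0)//.
    have := xM i; rewrite ler_norml; lra.
  exists [ffun i => Ordinal (um i)] => i; rewrite /lo ffunE /=.
  have /andP[h1 h2] := truncn_itv (u0 i).
  have uE : u i * eta = x 0 i + M by rewrite /u divfK// gt_eqF.
  have := ler_wpM2r (ltW eta0) h1; have := ler_wpM2r (ltW eta0) (ltW h2).
  rewrite uE -natr1; lra.
- move=> f x y xf yf; rewrite (le_trans (NK _))// mulrC -ler_pdivlMr//.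
  rewrite [leLHS]mx_normrE; apply/bigmax_leP; split; first exact: ltW.
  move=> [j i] _ /=; rewrite !mxE ord1 ler_norml.
  by have := xf i; have := yf i; rewrite -/eta; lra.
Qed.

Lemma pigeonhole_measure (P : probability 'rV[R]_d R) (I : finType)
    (F : I -> set 'rV[R]_d) (B : set 'rV[R]_d) :
  (forall i, measurable (F i)) -> measurable B ->
  (forall x, B x -> exists i, F i x) -> 0 < fine (P B) ->
  exists i, fine (P B) / #|I|%:R <= fine (P (B `&` F i)).
Proof.
move=> mF mB BF PB0; apply: contrapT => /forallNP H.
have mBF i : measurable (B `&` F i) by exact: measurableI.
have : (P B <= \sum_(i <- enum I) P (B `&` F i))%E.
  apply: le_trans (measure_bigsetU_le P (enum I) mBF).
  rewrite -bigcup_seq; apply: le_measure; rewrite ?inE//.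
    by rewrite bigcup_seq; apply: bigsetU_measurable => i _; exact: mBF.
  by move=> x Bx; have [i Fi] := BF _ Bx; exists i => //=; rewrite mem_enum.
rewrite -(fine_prob P mB) (eq_bigr (fun i => (fine (P (B `&` F i)))%:E)); last first.
  by move=> i _; rewrite fine_prob.
rewrite sumEFin lee_fin; apply/negP; rewrite -ltNge.
have I0 : (0 < #|I|)%N.
  rewrite lt0n; apply/eqP => I0.
  have [E|/set0P[x Bx]] := eqVneq B set0.
    by move: PB0; rewrite E measure0 ltxx.
  by have [i _] := BF _ Bx; have := fintype0 i I0.
apply: (@lt_le_trans _ _ (\sum_(i <- enum I) fine (P B) / #|I|%:R)).
  have [i0 _] : {i0 : I | true} by have /card_gt0P/sigW[i] := I0; exists i.
  apply: ltr_sum => [|i _]; last by rewrite ltNge; apply/negP; exact: H.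
  by apply/hasP; exists i0; rewrite ?mem_enum.
rewrite big_const_seq count_predT -cardE iter_addr_0 -[leLHS]mulr_natr divfK//.
by rewrite pnatr_eq0 -lt0n.
Qed.

End grid.

Section density_bounds.
Context (R : realType) (d : nat) (P : probability 'rV[R]_d R) (h : 'rV[R]_d -> R).
Context (hPh : is_density P h).
Local Notation lam := (lebesgue_rV R d).

Lemma density_le (E : set 'rV[R]_d) (M : R) : measurable E -> 0 <= M ->
  {ae lam, forall x, E x -> h x <= M} -> (P E <= M%:E * lam E)%E.
Proof.
have [mh h0 PE] := hPh => mE M0 hM; rewrite PE// -integral_cst//.
apply: ae_ge0_le_integral => //.
- by move=> x _; rewrite lee_fin.
- by apply/measurable_EFinP; apply: measurable_funTS.
Qed.

Lemma density_ge (E : set 'rV[R]_d) (m : R) : measurable E -> 0 <= m ->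
  {ae lam, forall x, E x -> m <= h x} -> (m%:E * lam E <= P E)%E.
Proof.
have [mh h0 PE] := hPh => mE m0 hm; rewrite PE// -integral_cst//.
apply: ae_ge0_le_integral => //.
- by move=> x _; rewrite lee_fin.
- by apply/measurable_EFinP; apply: measurable_funTS.
Qed.

Context (N : 'rV[R]_d -> R) (hN : is_norm N).

(** P charges a bounded set on which the density is bounded. *)
Lemma bounded_density_set : exists A (M L : R), [/\ measurable A, 0 < fine (P A),
  0 < M /\ 0 < L, forall x, A x -> N x <= L &
  forall B, measurable B -> (P (A `&` B) <= M%:E * lam B)%E].
Proof.
have [mh h0 PE] := hPh.
pose F (k : nat) : set 'rV[R]_d :=
  ([set: 'rV[R]_d] `&` [set x | N x <= k.+1%:R]) `&`
  ([set: 'rV[R]_d] `&` [set x | h x <= k.+1%:R]).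
have mF k : measurable (F k).
  apply: measurableI; apply: measurable_fun_le => //.
  by apply: continuous_measurable_rV; exact: is_norm_continuous.
have [k Fk] : exists k, P (F k) != 0%E.
  apply: contrapT => /forallNP H.
  have : P (\bigcup_k F k) = 0%E.
    apply: measure_negligible; first exact: bigcup_measurable.
    apply: negligible_bigcup => k; exists (F k); split=> //.
    by apply/eqP; have /negP := H k; rewrite negbK.
  rewrite (_ : \bigcup_k F k = setT).
    have -> : P setT = 1%E by exact: probability_setT.
    by move=> [] /eqP; rewrite oner_eq0.
  apply/seteqP; split=> // x _.
  pose k := Num.truncn (Num.max (N x) (h x)); exists k => //.
  have /andP[_ /ltW] : k%:R <= Num.max (N x) (h x) < k.+1%:R.
    by apply: truncn_itv; rewrite le_max norm_ge0.
  by rewrite ge_max => /andP[Nk hk]; split; split.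
exists (F k), k.+1%:R, k.+1%:R; split => //.
- by rewrite -lte_fin fine_prob// lt0e Fk measure_ge0.
- by move=> x [[_ +] _].
- move=> B mB; apply: (@le_trans _ _ (k.+1%:R%:E * lam (F k `&` B))%E).
    apply: density_le => //; first exact: measurableI.
    by apply: nearW => x [[_ [_ ]]].
  rewrite lee_wpmul2l ?lee_fin//; apply: le_measure; rewrite ?inE//.
  by apply: measurableI.
Qed.

End density_bounds.

Section near_codebook_measure.
Context (R : realType) (d : nat) (P : probability 'rV[R]_d R).
Context (N : 'rV[R]_d -> R) (hN : is_norm N).
Local Notation lam := (lebesgue_rV R d).

(** The closed t-neighbourhood of the points of s. *)
Definition near_seq (s : seq 'rV[R]_d) (t : R) : set 'rV[R]_d :=
  \bigcup_(a in [set` s]) nball N a t.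

Lemma measurable_near_seq s t : measurable (near_seq s t).
Proof.
rewrite /near_seq bigcup_seq; apply: bigsetU_measurable => a _.
exact: measurable_nball.
Qed.

Lemma near_seq_measure A (M w t : R) s : measurable A ->
  0 <= M -> 0 <= t ->
  (forall B, measurable B -> (P (A `&` B) <= M%:E * lam B)%E) ->
  (forall a t, 0 <= t -> (lam (nball N a t) <= (w * t ^+ d)%:E)%E) ->
  fine (P (A `&` near_seq s t)) <= (size s)%:R * (M * (w * t ^+ d)).
Proof.
move=> mA M0 t0 PM wt.
have mAn a : measurable (A `&` nball N a t).
  by apply: measurableI => //; exact: measurable_nball.
rewrite -lee_fin fine_prob; last by apply: measurableI => //; exact: measurable_near_seq.
rewrite /near_seq setI_bigcupr bigcup_seq.
apply: (le_trans (measure_bigsetU_le P s mAn)).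
apply: (@le_trans _ _ (\sum_(a <- s) (M * (w * t ^+ d))%:E)%E).
  apply: lee_sum => a _; apply: (le_trans (PM _ (measurable_nball hN a t))).
  by rewrite EFinM lee_wpmul2l ?lee_fin ?wt.
by rewrite sumEFin big_const_seq count_predT iter_addr_0 mulr_natl.
Qed.

End near_codebook_measure.

(** * Increments of the optimal distortion *)

Lemma half_le_l (R : realFieldType) (p a b : R) :
  p = a + b -> b <= p / 2 -> p / 2 <= a.
Proof. lra. Qed.

Section increments.
Context (R : realType) (d : nat) (hd : (0 < d)%N).
Context (N : 'rV[R]_d -> R) (hN : is_norm N) (r : R) (hr : 0 < r).
Context (P : probability 'rV[R]_d R) (h : 'rV[R]_d -> R) (hPh : is_density P h).
Context (delta : R) (delta0 : 0 < delta).
Context (hmoment : (\int[P]_x (N x `^ (r + delta))%:E < +oo)%E).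

Local Notation lam := (lebesgue_rV R d).
Local Notation tau := (tau R d).
Local Notation err := (err N r P).

Let fm := finite_moment hN hr delta0 hmoment.

Lemma expr_le_id (x : R) : 0 <= x <= 1 -> x ^+ d <= x.
Proof.
move=> /andP[x0 x1]; case: d hd => // k _; rewrite exprS.
by rewrite ler_piMr// exprn_ile1.
Qed.

Lemma id_le_expr (x : R) : 1 <= x -> x <= x ^+ d.
Proof.
move=> x1; case: d hd => // k _; rewrite exprS.
by rewrite ler_peMr ?exprn_ege1// (le_trans ler01).
Qed.

Lemma gain_gt0 : 0 < (3 / 4) `^ r - 4^-1 `^ r :> R.
Proof. by rewrite subr_gt0; apply: (gt0_ltr_powR hr); rewrite ?nnegrE; lra. Qed.

Lemma tau_le1 n : (0 < n)%N -> tau n <= 1.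
Proof. by move=> n0; have := @tau_le R d 1 n n0; rewrite [tau 1]tauE powR1. Qed.

(** Lower bound on the increments of the optimal distortion: some additional point
    always helps by at least c * tau(n)^r / n. *)
Lemma err_add_point : exists2 c : R, 0 < c & forall n (s : seq 'rV[R]_d),
  s != [::] -> (size s <= n)%N ->
  exists y, err (y :: s) + c * (tau n `^ r / n%:R) <= err s.
Proof.
have [A [M [L [mA PA0 [M0 L0] AL PM]]]] := bounded_density_set hPh hN.
have [w w0 wt] := lebesgue_nball_le hN.
have [Q Q0 grid] := grid_cover hN L0.
set p := fine (P A) in PA0.
(* k is chosen so that n balls of radius k * tau(n) cover at most half of A. *)
pose q := p / (2 * (M * w)).
have q0 : 0 < q by rewrite divr_gt0// !mulr_gt0.
have [k k0 [k1 kq]] : exists2 k : R, 0 < k & k <= 1 /\ k <= q.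
  by exists (Num.min 1 q); rewrite ?lt_min ?ltr01// !ge_min !lexx orbT.
have kd : M * (w * k ^+ d) <= p / 2.
  have H1 : k ^+ d <= q by rewrite (le_trans (expr_le_id _))// (ltW k0).
  have H2 := ler_wpM2l (ltW (mulr_gt0 M0 w0)) H1.
  rewrite mulrA (le_trans H2)// /q.
  have Mw := mulr_gt0 M0 w0.
  by rewrite le_eqVlt; apply/orP; left; apply/eqP; field; rewrite !gt_eqF.
pose g : R := (3 / 4) `^ r - 4^-1 `^ r.
have g0 : 0 < g by exact: gain_gt0.
exists (g * k `^ r * (p / 2 * ((k / 4) ^+ d / Q))).
  by rewrite !mulr_gt0 ?powR_gt0 ?exprn_gt0 ?invr_gt0// divr_gt0.
move=> n s s0 sn.
have n0 : (0 < n)%N by rewrite (leq_trans _ sn)// lt0n size_eq0.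
have n0' : 0 < n%:R :> R by rewrite ltr0n.
have tn0 := tau_gt0 R d n0.
have tn1 := tau_le1 n0.
set t := k * tau n.
have t0 : 0 < t by rewrite mulr_gt0.
have t1 : t <= 1 by rewrite mulr_ile1// ltW.
have td : t ^+ d = k ^+ d / n%:R by rewrite exprMn tauX.
set U := near_seq N s t.
have mU : measurable U by exact: measurable_near_seq.
have PU : fine (P (A `&` U)) <= p / 2.
  apply: (le_trans (near_seq_measure hN s mA (ltW M0) (ltW t0) PM wt)).
  rewrite td; apply: (@le_trans _ _ (n%:R * (M * (w * (k ^+ d / n%:R))))).
    rewrite ler_wpM2r ?ler_nat// !mulr_ge0 ?invr_ge0 ?(ltW M0) ?(ltW w0)//.
    by rewrite exprn_ge0 ?(ltW k0).
  rewrite (_ : n%:R * _ = M * (w * k ^+ d))//.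
  by field; rewrite gt_eqF.
have PAU : p / 2 <= fine (P (A `\` U)).
  have : p = fine (P (A `\` U)) + fine (P (A `&` U)).
    apply/EFin_inj; rewrite EFinD !fine_prob//; last 2 first.
    - exact: measurableI.
    - exact: measurableD.
    by rewrite -measureDI.
  by move=> /half_le_l; exact.
have mAU : measurable (A `\` U) by exact: measurableD.
have t4 : 0 < t / 4 <= 1 by rewrite divr_gt0//=; lra.
have [I [F [mF cardI FL Fdiam]]] := grid (t / 4) t4.
have PAU0 : 0 < fine (P (A `\` U)) by rewrite (lt_le_trans _ PAU)// divr_gt0.
have [|i Fi] := pigeonhole_measure mF mAU _ PAU0.
  by move=> x [/AL Ax _]; exact: FL.
have I0 : 0 < #|I|%:R :> R by rewrite ltr0n; apply/card_gt0P; exists i.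
set B := (_ `&` F i) in Fi.
have mB : measurable B by exact: measurableI.
have B0 : 0 < fine (P B) by rewrite (lt_le_trans _ Fi)// divr_gt0.
have [y [[Ay Uy] Fy]] : B !=set0.
  by apply/set0P; apply/eqP => E; move: B0; rewrite E measure0 ltxx.
have ty : t <= qdist N s y.
  have [a sa ->] := qdist_attained N y s0.
  by rewrite leNgt; apply/negP => /ltW ya; apply: Uy; exists a.
have key : p / 2 * ((t / 4) ^+ d / Q) <= fine (P (nball N y (t / 4))).
  apply: (@le_trans _ _ (fine (P B))).
    apply: le_trans Fi; apply: ler_pM; rewrite ?divr_ge0 ?exprn_ge0 ?(ltW Q0) ?(ltW PA0)//.
      by rewrite divr_ge0 ?(ltW t0).
    have t4d : 0 < (t / 4) ^+ d by rewrite exprn_gt0// divr_gt0.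
    by rewrite -[leLHS]invrK lef_pV2 ?posrE ?invr_gt0 ?divr_gt0// invf_div.
  rewrite -lee_fin !fine_prob//; last exact: measurable_nball.
  apply: le_measure; rewrite ?inE//; first exact: measurable_nball.
  by move=> x [_ Fx]; exact: Fdiam Fx Fy.
exists y; apply: le_trans (err_gain hN hr fm s0 (y := y) (t := t) _); last first.
  by rewrite (ltW t0).
rewrite lerD2l -/g.
rewrite [leLHS](_ : _ = g * t `^ r * (p / 2 * ((t / 4) ^+ d / Q))); last first.
  rewrite [(k / 4) ^+ d]exprMn [(t / 4) ^+ d]exprMn td /t powRM ?(ltW k0) ?(ltW tn0)//.
  by field; rewrite !gt_eqF.
by rewrite ler_wpM2l// mulr_ge0 ?powR_ge0 ?(ltW g0).
Qed.

Lemma err_nil : err [::] = 0.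
Proof.
apply/EFin_inj; rewrite -(errE hN hr fm).
under eq_integral do rewrite qdist_nil powR0 ?gt_eqF//.
by rewrite integral0.
Qed.

(** Some point of s other than a lies at distance at most t from a. *)
Definition has_neighbour (s : seq 'rV[R]_d) (t : R) (a : 'rV[R]_d) : bool :=
  has (fun b => (b != a) && (N (a - b) <= t)) s.

(** At each x only the deletion of the point of s nearest to x changes the distance,
    and a neighbour of that point replaces it at the price of t. *)
Lemma sum_err_rem (s b : seq 'rV[R]_d) (t : R) : uniq s -> uniq b ->
  {subset b <= s} -> 0 <= t -> (forall a, a \in b -> has_neighbour s t a) ->
  s != [::] ->
  \sum_(a <- b) err (rem a s) <=
    (size b)%:R * err s + 2 `^ r * (err s + t `^ r).
Proof.
move=> us ub bs t0 bt s0.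
pose v x := 2 `^ r * (qdist N s x `^ r + t `^ r).
have v0 x : 0 <= v x by rewrite mulr_ge0 ?powR_ge0 ?addr_ge0 ?powR_ge0.
have pointwise x : \sum_(a <- b) qdist N (rem a s) x `^ r <=
    (size b)%:R * qdist N s x `^ r + v x.
  have [c sc qc] := qdist_attained N x s0.
  apply: (@le_trans _ _
      (\sum_(a <- b) (qdist N s x `^ r + (a == c)%:R * v x))).
    rewrite big_seq [leRHS]big_seq; apply: ler_sum => a ba.
    have [E|ac] := eqVneq a c; last first.
      rewrite mul0r addr0 qc.
      apply: (ge0_ler_powR (ltW hr)); rewrite ?nnegrE ?qdist_ge0 ?norm_ge0//.
      by apply: qdist_le; rewrite mem_rem_uniq// !inE eq_sym ac.
    rewrite mul1r -[leLHS]add0r lerD ?powR_ge0//.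
    apply: le_trans (powR_add_le (ltW hr) (qdist_ge0 hN _ _) t0).
    have /hasP[e se /andP[ea aet]] := bt _ ba.
    apply: (ge0_ler_powR (ltW hr)); rewrite ?nnegrE ?addr_ge0 ?qdist_ge0 ?norm_ge0//.
    apply: (@le_trans _ _ (N (x - e))).
      by apply: qdist_le; rewrite mem_rem_uniq// !inE ea.
    by rewrite qc (le_trans (normBD hN c _ _))// lerD2l -E.
  rewrite big_split /= big_const_seq count_predT iter_addr_0 mulr_natl lerD2l.
  rewrite -mulr_suml ler_piMl//.
  have -> : \sum_(a <- b) (a == c)%:R = (count_mem c b)%:R :> R.
    by elim: (b) => [|a l ih]; rewrite ?big_nil// big_cons ih /= natrD.
  by rewrite count_uniq_mem// lern1 leq_b1.
have mq s' := measurable_qdist_powR hN r s'.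
have mv : measurable_fun setT v.
  by apply: measurable_funM => //; apply: measurable_funD.
have : ((\sum_(a <- b) err (rem a s))%:E <=
    ((size b)%:R * err s + 2 `^ r * (err s + t `^ r))%:E)%E.
  have -> : (((size b)%:R * err s + 2 `^ r * (err s + t `^ r))%:E =
      \int[P]_x ((size b)%:R * qdist N s x `^ r + v x)%:E)%E.
    rewrite intD//; last 2 first.
    - exact: measurable_funM.
    - by move=> x; rewrite mulr_ge0 ?powR_ge0.
    rewrite intZ//; last by move=> x; exact: powR_ge0.
    rewrite intZ ?powR_ge0//; last 2 first.
    - exact: measurable_funD.
    - by move=> x; rewrite addr_ge0 ?powR_ge0.
    rewrite intD//; last 2 first.
    - by move=> x; exact: powR_ge0.
    - by move=> x; exact: powR_ge0.
    by rewrite (errE hN hr fm) int_cst.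
  rewrite -sumEFin; under eq_bigr do rewrite -(errE hN hr fm).
  rewrite -ge0_integral_sum//.
  - apply: ge0_le_integral => //.
    + by move=> x _; rewrite sume_ge0// => a _; rewrite lee_fin powR_ge0.
    + by apply: emeasurable_sum => a; exact/measurable_EFinP.
    + apply/measurable_EFinP; apply: measurable_funD => //.
      exact: measurable_funM.
    + by move=> x _; rewrite sumEFin lee_fin.
  - by move=> a; exact/measurable_EFinP.
  - by move=> a x _; rewrite lee_fin powR_ge0.
by rewrite lee_fin.
Qed.

(** Points of a ball that are pairwise more than t apart lie in distinct pieces of a
    covering by sets of diameter at most t. *)
Lemma size_isolated (L Q t : R) (s : seq 'rV[R]_d) : uniq s ->
  (forall a, a \in s -> N a <= L) ->
  (forall a b, a \in s -> b \in s -> a != b -> t < N (a - b)) ->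
  (exists (I : finType) (F : I -> set 'rV[R]_d),
    [/\ forall i, measurable (F i), #|I|%:R <= Q / t ^+ d,
        forall x, N x <= L -> exists i, F i x &
        forall i x y, F i x -> F i y -> N (x - y) <= t]) ->
  (size s)%:R <= Q / t ^+ d.
Proof.
move=> us sL st [I [F [_ cardI FL Ft]]]; apply: le_trans cardI; rewrite ler_nat.
have [->//|] := eqVneq s [::]; case: s us sL st => // a0 s'.
set s := a0 :: s' => us sL st _.
have [i0 _] := FL a0 (sL _ (mem_head _ _)).
pose f a := if pselect (exists i, F i a) is left e then sval (cid e) else i0.
have fP a : a \in s -> F (f a) a.
  by move=> /sL/FL e; rewrite /f; case: pselect => // e'; case: cid.
rewrite -(size_map f) -(card_uniqP _) ?max_card//.
rewrite map_inj_in_uniq// => a b sa sb fab; apply/eqP/negPn/negP => ab.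
have := st _ _ sa sb ab; rewrite ltNge => /negP; apply.
by apply: Ft (fP _ sa) _; rewrite fab; exact: fP.
Qed.

(** Upper bound on the increments of the optimal distortion: some point of an
    optimal codebook can be deleted at a cost of at most C * tau(n)^r / n. *)
Lemma err_drop_point : exists2 C : R, 0 < C & exists n1 : nat,
  forall n (s : seq 'rV[R]_d), (n1 <= n)%N -> uniq s -> s != [::] ->
  (size s <= n)%N ->
  (forall s' : seq 'rV[R]_d, s' != [::] -> (size s' <= n)%N -> err s <= err s') ->
  exists s' : seq 'rV[R]_d, [/\ s' != [::], (size s' <= n.-1)%N &
    err s' <= err s + C * (tau n `^ r / n%:R)].
Proof.
have [A [M [L [mA PA0 [M0 L0] AL PM]]]] := bounded_density_set hPh hN.
have [w w0 wt] := lebesgue_nball_le hN.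
have L20 : 0 < 2 * L by rewrite mulr_gt0.
have [Q Q0 grid] := grid_cover hN L20.
have [C0 C00 [n2 pierceP]] := pierce hd hN hr delta0 hmoment.
set p := fine (P A) in PA0.
have p20 : 0 < p / 2 by rewrite divr_gt0.
(* T makes (T * tau(n))^r * P(A) / 2 exceed the Pierce bound, so that the points
   of an optimal codebook in a ball must come T * tau(n)-close to half of A. *)
pose T := ((C0 + 1) / (p / 2)) `^ r^-1.
have T0 : 0 < T by rewrite powR_gt0// divr_gt0// ltr_wpDl// ltW.
have Tr : T `^ r * (p / 2) = C0 + 1.
  rewrite /T -powRrM mulVf ?gt_eqF// powRr1 ?divfK ?gt_eqF//.
  by rewrite divr_ge0 ?(ltW p20)// addr_ge0// ltW.
pose k := p / 2 / (M * (w * T ^+ d)).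
have MwT : 0 < M * (w * T ^+ d) by rewrite !mulr_gt0 ?exprn_gt0.
have k0 : 0 < k by rewrite divr_gt0.
(* T' makes the number of points without a neighbour at distance T' * tau(n) at
   most k * n / 2. *)
pose T' := Num.max 1 (2 * Q / k).
have T'1 : 1 <= T' by rewrite le_max lexx.
have T'0 : 0 < T' by exact: lt_le_trans T'1.
have T'd : 2 * Q / k <= T' ^+ d.
  by rewrite (le_trans _ (id_le_expr T'1))// le_max lexx orbT.
pose C := 2 / k * (2 `^ r * (C0 + T' `^ r)).
have CT : 0 < C0 + T' `^ r by rewrite ltr_wpDr ?powR_ge0.
exists C; first by rewrite !mulr_gt0 ?powR_gt0 ?invr_gt0.
have [n3 tauT] := tau_small hd (divr_gt0 L0 T0).
have [n4 tauT'] := tau_small hd (divr_gt0 ltr01 T'0).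
exists (maxn 1 (maxn n2 (maxn n3 n4))) => n s.
rewrite !geq_max => /and4P[n0 /pierceP[sp [sp0 spn errsp]] /tauT tn /tauT' tn'].
move=> us s0 sn opt.
have n0' : 0 < n%:R :> R by rewrite ltr0n.
have tn0 := tau_gt0 R d n0.
have errs : err s <= C0 * tau n `^ r by rewrite (le_trans (opt sp sp0 spn)).
set t := T * tau n.
have t0 : 0 < t by rewrite mulr_gt0.
have tL : t <= L by rewrite /t mulrC -ler_pdivlMr.
have td : t ^+ d = T ^+ d / n%:R by rewrite exprMn tauX.
set t' := T' * tau n.
have t'0 : 0 < t' by rewrite mulr_gt0.
have t'1 : t' <= 1 by rewrite /t' mulrC -ler_pdivlMr.
have t'd : t' ^+ d = T' ^+ d / n%:R by rewrite exprMn tauX.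
pose s1 := [seq a <- s | N a <= 2 * L].
have us1 : uniq s1 by exact: filter_uniq.
have size_s1 : k * n%:R < (size s1)%:R.
  set U := near_seq N s1 t.
  have mU : measurable U by exact: measurable_near_seq.
  have PU := near_seq_measure hN s1 mA (ltW M0) (ltW t0) PM wt.
  suff PU' : p / 2 < fine (P (A `&` U)).
    have := lt_le_trans PU' PU.
    rewrite td (_ : M * _ = M * (w * T ^+ d) / n%:R); last by ring.
    by rewrite mulrA ltr_pdivlMr// -ltr_pdivrMr// /k mulrAC.
  rewrite ltNge; apply/negP => PU'.
  have mAU : measurable (A `\` U) by exact: measurableD.
  have PAU : p / 2 <= fine (P (A `\` U)).
    have : p = fine (P (A `\` U)) + fine (P (A `&` U)).
      apply/EFin_inj; rewrite EFinD !fine_prob//; last exact: measurableI.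
      by rewrite -measureDI.
    by move=> /half_le_l; exact.
  have : err [::] + t `^ r * fine (P (A `\` U)) <= err s.
    apply: (err_indic_ge hN hr fm mAU (powR_ge0 _ _)) => x.
    rewrite qdist_nil powR0 ?gt_eqF// add0r indicE.
    case: (boolP (x \in A `\` U)) => [/set_mem[Ax Ux]|_]; last first.
      by rewrite mulr0 powR_ge0.
    rewrite mulr1; apply: (ge0_ler_powR (ltW hr)); rewrite ?nnegrE ?qdist_ge0 ?(ltW t0)//.
    have [a sa ->] := qdist_attained N x s0.
    have [aL|La] := leP (N a) (2 * L).
      rewrite leNgt; apply/negP => /ltW ya; apply: Ux; exists a => //=.
      by rewrite mem_filter aL.
    have := AL x Ax; have := normD hN (a - x) x.
    rewrite subrK (normBC hN a x); clear -La tL; lra.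
  rewrite err_nil add0r => H.
  have {}H := le_trans H errs.
  have := ler_wpM2l (powR_ge0 t r) PAU => /le_trans/(_ H).
  rewrite /t powRM ?(ltW T0) ?(ltW tn0)// mulrAC Tr mulrDl.
  apply/negP; rewrite -ltNge ltrDl mul1r; exact: powR_gt0.
pose good := [seq a <- s1 | has_neighbour s t' a].
pose bad := [seq a <- s1 | ~~ has_neighbour s t' a].
have size_bad : (size bad)%:R <= k / 2 * n%:R.
  apply: (@le_trans _ _ (Q / t' ^+ d)).
    apply: (@size_isolated (2 * L)).
    - exact: filter_uniq.
    - by move=> a; rewrite !mem_filter => /and3P[].
    - move=> a b; rewrite !mem_filter => /and3P[/hasPn ha _ _] /and3P[_ _ sb] ab.
      by have := ha _ sb; rewrite eq_sym ab /= -ltNge.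
    - by apply: grid; rewrite t'0.
  rewrite t'd invf_div mulrA ler_pdivrMr ?exprn_gt0// mulrAC ler_wpM2r//.
  by move: T'd; rewrite ler_pdivrMr// mulrC; clear; lra.
have size_good : k / 2 * n%:R < (size good)%:R.
  have : (size s1)%:R = (size good)%:R + (size bad)%:R :> R.
    rewrite -natrD [size good]size_filter [size bad]size_filter.
    by rewrite -(count_predC (has_neighbour s t') s1).
  by move: size_s1 size_bad; clear; lra.
have good0 : 0 < (size good)%:R :> R.
  have k20 : 0 < k / 2 by rewrite divr_gt0.
  by apply: lt_trans size_good; exact: mulr_gt0.
apply: contrapT => /forallNP H.
have H' a : a \in good -> err s + C * (tau n `^ r / n%:R) <= err (rem a s).
  rewrite !mem_filter => /and3P[/hasP[b sb /andP[ba _]] _ sa].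
  rewrite leNgt; apply/negP => /ltW ea; apply: (H (rem a s)); split => //.
    have : b \in rem a s by rewrite mem_rem_uniq// !inE ba.
    by apply: contraTneq => ->.
  rewrite size_rem//; case: (size s) sn => // m mn.
  by rewrite -ltnS /= prednK.
have sub : {subset good <= s} by move=> a; rewrite !mem_filter => /and3P[].
have gn a : a \in good -> has_neighbour s t' a by rewrite mem_filter => /andP[].
have := sum_err_rem us (filter_uniq _ us1) sub (ltW t'0) gn s0.
apply/negP; rewrite -ltNge.
apply: (@lt_le_trans _ _ (\sum_(a <- good) (err s + C * (tau n `^ r / n%:R)))); last first.
  by rewrite big_seq [leRHS]big_seq; apply: ler_sum.
rewrite big_const_seq count_predT iter_addr_0 -[ltRHS]mulr_natl [ltRHS]mulrDr.
rewrite -/good ltrD2l.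
have tr0 : 0 < tau n `^ r by exact: powR_gt0.
apply: (@le_lt_trans _ _ (k / 2 * n%:R * (C * (tau n `^ r / n%:R)))); last first.
  rewrite ltr_pM2r// !mulr_gt0 ?invr_gt0 ?powR_gt0//.
rewrite (_ : k / 2 * n%:R * _ = 2 `^ r * ((C0 + T' `^ r) * tau n `^ r)); last first.
  by rewrite /C; field; rewrite !gt_eqF.
rewrite ler_wpM2l ?powR_ge0// mulrDl /t' powRM ?(ltW T'0) ?(ltW tn0)//.
by rewrite lerD2r.
Qed.

End increments.

(** * Voronoi cells and optimal codebooks *)

Section voronoi_cells.
Context (R : realType) (d : nat) (N : 'rV[R]_d -> R) (hN : is_norm N).
Implicit Types (s : seq 'rV[R]_d) (a x : 'rV[R]_d).

Lemma voronoi_seqE s a : s != [::] ->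
  voronoi N [set` s] a = [set x | N (x - a) = qdist N s x].
Proof.
move=> s0; apply/seteqP; split=> x; rewrite /voronoi /= dist_qdist//.
  by case.
by move=> ->.
Qed.

Lemma set_seqD1 s a : uniq s -> [set` s] `\ a = [set` rem a s].
Proof.
move=> us; apply/seteqP; split=> x /=.
  by move=> [sx /eqP xa]; rewrite mem_rem_uniq// !inE xa.
by rewrite mem_rem_uniq// !inE => /andP[/eqP xa sx].
Qed.

Lemma open_voronoi_seqE s a : uniq s -> rem a s != [::] ->
  open_voronoi N [set` s] a = [set x | N (x - a) < qdist N (rem a s) x].
Proof.
move=> us s0; rewrite /open_voronoi set_seqD1//.
by apply/seteqP; split=> x; rewrite /= dist_qdist// lte_fin.
Qed.

Lemma measurable_voronoi s a : s != [::] -> measurable (voronoi N [set` s] a).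
Proof.
move=> s0; rewrite voronoi_seqE//.
rewrite (_ : mkset _ = (setT `&` [set x | N (x - a) <= qdist N s x]) `&`
    (setT `&` [set x | qdist N s x <= N (x - a)])).
  by apply: measurableI; apply: measurable_fun_le => //;
    (exact: measurable_normB || exact: measurable_qdist).
rewrite !setTI; apply/seteqP; split => x /=; first by move=> ->.
by move=> [xa ax]; apply/eqP; rewrite eq_le xa.
Qed.

Lemma measurable_open_voronoi s a : uniq s -> rem a s != [::] ->
  measurable (open_voronoi N [set` s] a).
Proof.
move=> us s0; rewrite open_voronoi_seqE//.
rewrite (_ : mkset _ = ~` (setT `&` [set x | qdist N (rem a s) x <= N (x - a)])).
  by apply: measurableC; apply: measurable_fun_le => //;
    (exact: measurable_normB || exact: measurable_qdist).
rewrite setTI; apply/seteqP; split => x /=; first by rewrite ltNge => /negP.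
by rewrite ltNge => /negP.
Qed.

(** The open cell of a is contained in its Voronoi cell. *)
Lemma qdist_rem_cell s a x : uniq s -> a \in s -> rem a s != [::] ->
  N (x - a) < qdist N (rem a s) x -> N (x - a) = qdist N s x.
Proof.
move=> us sa s0 xa; apply/eqP; rewrite eq_le qdist_le// andbT.
have [|c + ->] := @qdist_attained _ _ N s x.
  by apply: contraTneq sa => ->.
have [-> //|ca sc] := eqVneq c a.
apply: (le_trans (ltW xa)); apply: qdist_le.
by rewrite mem_rem_uniq// !inE ca.
Qed.

(** Off the open cell of a, deleting a does not increase the distance. *)
Lemma qdist_rem_off_cell s a x : uniq s -> a \in s ->
  qdist N (rem a s) x <= N (x - a) -> qdist N (rem a s) x <= qdist N s x.
Proof.
move=> us sa xa.
have [|c + ->] := @qdist_attained _ _ N s x.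
  by apply: contraTneq sa => ->.
have [-> //|ca sc] := eqVneq c a.
by apply: qdist_le; rewrite mem_rem_uniq// !inE ca.
Qed.

(** Voronoi cells are star-shaped about their centre, for every norm. *)
Lemma voronoi_star s a x (l : R) : a \in s -> N (x - a) = qdist N s x ->
  0 <= l <= 1 -> qdist N s (a + l *: (x - a)) = l * N (x - a).
Proof.
move=> sa xa /andP[l0 l1].
have za : a + l *: (x - a) - a = l *: (x - a) by rewrite addrAC subrr add0r.
have Nza : N (a + l *: (x - a) - a) = l * N (x - a).
  by rewrite za (normZ hN) ger0_norm.
apply/eqP; rewrite eq_le -{1}Nza qdist_le//=.
have [|c sc ->] := @qdist_attained _ _ N s (a + l *: (x - a)).
  by apply: contraTneq sa => ->.
have xz : x - (a + l *: (x - a)) = (1 - l) *: (x - a).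
  by rewrite scalerBl scale1r opprD addrA.
have Nxz : N (x - (a + l *: (x - a))) = (1 - l) * N (x - a).
  by rewrite xz (normZ hN) ger0_norm// subr_ge0.
have := qdist_le N x sc; rewrite -xa.
have := normBD hN (a + l *: (x - a)) x c; rewrite Nxz; lra.
Qed.

Lemma unit_vector : (0 < d)%N -> exists e : 'rV[R]_d, N e = 1.
Proof.
move=> hd; have [_ _ N0] := hN.
pose v : 'rV[R]_d := const_mx 1.
have Nv : 0 < N v.
  rewrite lt_neqAle norm_ge0// andbT eq_sym; apply/eqP => /N0 /matrixP.
  move=> /(_ ord0 (Ordinal hd)); rewrite !mxE => /eqP.
  by rewrite oner_eq0.
exists ((N v)^-1 *: v); rewrite (normZ hN) ger0_norm ?invr_ge0 ?ltW//.
by rewrite mulVf// gt_eqF.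
Qed.

End voronoi_cells.

Section optimal_codebooks.
Context (R : realType) (d : nat) (hd : (0 < d)%N).
Context (N : 'rV[R]_d -> R) (hN : is_norm N) (r : R) (hr : 0 < r).
Context (P : probability 'rV[R]_d R).
Context (fm : (\int[P]_x (N x `^ r)%:E < +oo)%E).
Local Notation err := (err N r P).

(** A duplicate-free list of the points of an n-optimal codebook. *)
Definition optimal_seq (n : nat) (s : seq 'rV[R]_d) : Prop :=
  [/\ uniq s, s != [::], (size s <= n)%N &
   forall s', s' != [::] -> (size s' <= n)%N -> err s <= err s'].

Lemma card_le_set_seq (s : seq 'rV[R]_d) n : (size s <= n)%N ->
  ([set` s] #<= `I_n)%card.
Proof.
move=> sn; apply: card_le_trans (card_image_le (nth 0 s) `I_n).
apply: subset_card_le => x /= sx; exists (index x s); last exact: nth_index.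
by rewrite /= (leq_trans _ sn)// index_mem.
Qed.

Lemma optimal_codebook_seq n (A : set 'rV[R]_d) : (0 < n)%N ->
  optimal_codebook N r P n A -> exists2 s, A = [set` s] & optimal_seq n s.
Proof.
move=> n0 [An dA].
have fA : finite_set A by apply/finite_set_leP; exists n.
pose s : seq 'rV[R]_d := finmap.enum_fset (fset_set A).
have AE : A = [set` s] by rewrite -[LHS](fset_setK fA).
have opt s' : s' != [::] -> (size s' <= n)%N ->
    (distortion N r P A <= (err s')%:E)%E.
  move=> s0 sn; rewrite dA -(distortion_err hN hr fm s0).
  apply: ereal_inf_lbound; exists [set` s'] => //; split.
    by case: s' s0 {sn} => // a s' _; exists a => /=; rewrite mem_head.
  exact: card_le_set_seq.
have s0 : s != [::].
  apply/eqP => s0; have := opt [:: 0] isT n0.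
  rewrite AE s0 (_ : [set` [::]] = set0); last by apply/seteqP; split.
  by rewrite distortion_set0.
exists s; first exact: AE.
split; first exact: finmap.fset_uniq.
- exact: s0.
- exact: geq_card_fset_set.
- move=> s' s'0 s'n; have := opt _ s'0 s'n.
  by rewrite AE (distortion_err hN hr fm s0) lee_fin.
Qed.

End optimal_codebooks.

(** * Cells near a set where the density is bounded *)

Section linear_arithmetic.
Context {F : realFieldType}.
Implicit Types u v x y c e rho : F.

Lemma quarter_le u e : 0 < u -> u <= e -> u / 4 <= e. Proof. lra. Qed.

Lemma lt_double rho : 0 < rho -> rho < 2 * rho. Proof. lra. Qed.

Lemma increment_absurd x c u v y :
  y + x <= u -> v <= y -> u <= v + c -> 0 < c -> 2 * c <= x -> False.
Proof. lra. Qed.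

Lemma half_of_sixth rho e u v y : 6 * rho <= e -> u <= 2 * rho -> v <= rho ->
  y <= u + v -> y <= e / 2.
Proof. lra. Qed.

End linear_arithmetic.

Section local_bounds.
Context (R : realType) (d : nat) (hd : (0 < d)%N).
Context (N : 'rV[R]_d -> R) (hN : is_norm N) (r : R) (hr : 0 < r).
Context (P : probability 'rV[R]_d R) (h : 'rV[R]_d -> R) (hPh : is_density P h).
Context (delta : R) (delta0 : 0 < delta).
Context (hmoment : (\int[P]_x (N x `^ (r + delta))%:E < +oo)%E).
Context (S : nat -> seq 'rV[R]_d).
Context (optS : forall n, (0 < n)%N -> optimal_seq N r P n (S n)).

Local Notation lam := (lebesgue_rV R d).
Local Notation tau := (tau R d).
Local Notation err := (err N r P).
Local Notation D := (d%:R : R).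

Let fm := finite_moment hN hr delta0 hmoment.

Lemma tau_powR_le m n : (0 < m <= n)%N ->
  tau n `^ r / n%:R <= tau m `^ r / m%:R.
Proof.
move=> /[dup] /tau_le-/(_ R d) mn /andP[m0 lemn].
have n0 : (0 < n)%N by exact: leq_trans lemn.
apply: ler_pM; [exact: powR_ge0|by rewrite invr_ge0 ler0n| |].
  apply: (ge0_ler_powR (ltW hr)); last exact: mn.
    by rewrite nnegrE (ltW (tau_gt0 R d n0)).
  by rewrite nnegrE (ltW (tau_gt0 R d m0)).
by rewrite lef_pV2 ?posrE ?ltr0n// ler_nat.
Qed.

Lemma err_increment_le : exists2 C : R, 0 < C & exists n1 : nat,
  forall n, (n1 <= n)%N -> err (S n) <= err (S n.+1) + C * (tau n `^ r / n%:R).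
Proof.
have [C C0 [n1 H]] := err_drop_point hd hN hr hPh delta0 hmoment.
exists C => //; exists n1.+1 => n n1n.
have n0 : (0 < n)%N by exact: leq_trans n1n.
have [us s0 sn opt] := optS (ltn0Sn n).
have [s' [s'0 s'n es']] := H n.+1 _ (leq_trans (ltnW n1n) (leqnSn _)) us s0 sn opt.
have [_ _ _ optn] := optS n0.
apply: (le_trans (optn s' s'0 s'n)); apply: (le_trans es'); rewrite lerD2l.
by apply: (ler_wpM2l (ltW C0)); apply: tau_powR_le; rewrite n0 leqnSn.
Qed.

Lemma err_decrement_ge : exists2 c : R, 0 < c & forall n s', (0 < n)%N ->
  s' != [::] -> (size s' <= n.-1)%N ->
  err (S n) + c * (tau n `^ r / n%:R) <= err s'.
Proof.
have [c c0 H] := err_add_point hd hN hr hPh delta0 hmoment.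
exists c => // n s' n0 s'0 s'n.
have [y ys'] := H n.-1 s' s'0 s'n.
have m0 : (0 < n.-1)%N by rewrite (leq_trans _ s'n)// lt0n size_eq0.
have [_ _ _ optn] := optS n0.
apply: le_trans ys'; apply: lerD.
  by apply: optn => //=; rewrite -(prednK n0) ltnS.
by apply: (ler_wpM2l (ltW c0)); apply: tau_powR_le; rewrite m0 leq_pred.
Qed.

(** Where P has at least m times the volume of every small ball, the codebook is
    G * m^(-1/(r+d)) * tau(n)-dense: a larger hole would give, when a point is put in
    its middle, a gain above the largest possible increment of the distortion. *)
Lemma qdist_small : exists2 G : R, 0 < G & forall (m eps : R) (Y : set 'rV[R]_d),
  0 < m -> 0 < eps ->
  (forall y t, Y y -> 0 <= t <= eps ->
     (m%:E * lam (nball N y t) <= P (nball N y t))%E) ->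
  exists n0 : nat, forall n y, (n0 <= n)%N -> Y y ->
    qdist N (S n) y <= G * m `^ (- (r + D)^-1) * tau n.
Proof.
have [C C0 [n1 HC]] := err_increment_le.
have [w w0 wt] := lebesgue_nball_ge hN.
pose g : R := (3 / 4) `^ r - 4^-1 `^ r.
have g0 : 0 < g by exact: gain_gt0.
have [B B0 BE] : exists2 B : R, 0 < B & B = g * w * 4^-1 ^+ d.
  by exists (g * w * 4^-1 ^+ d) => //; rewrite !mulr_gt0 ?exprn_gt0.
have rD : 0 < r + D by rewrite addr_gt0 ?ltr0n.
(* The gain from a hole of radius G * m^(-1/(r+d)) * tau(n) is twice the bound C on
   the increments. *)
pose G := (2 * C / B) `^ (r + D)^-1.
have CB : 0 < 2 * C / B by rewrite divr_gt0 ?mulr_gt0.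
have G0 : 0 < G by rewrite powR_gt0.
exists G => // m eps Y m0 eps0 HY.
set b := m `^ _.
have b0 : 0 < b by rewrite powR_gt0.
have [a a0 aE] : exists2 a : R, 0 < a & a = G * b.
  by exists (G * b) => //; rewrite mulr_gt0.
have ard : a `^ r * a ^+ d = 2 * C / B / m.
  rewrite -powR_mulrn ?(ltW a0)// -powRD; last by rewrite (gt_eqF a0) implybT.
  rewrite aE powRM ?(ltW G0) ?(ltW b0)//; congr (_ * _).
    by rewrite /G -powRrM mulVf ?gt_eqF// powRr1// ltW.
  by rewrite /b -powRrM mulNr mulVf ?gt_eqF// powR_inv1// ltW.
have [n2 tau2] := tau_small hd (divr_gt0 eps0 a0).
exists (maxn 1 (maxn n1 n2)) => n y; rewrite !geq_max => /and3P[n0 n1n /tau2 tn Yy].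
have tn0 := tau_gt0 R d n0.
rewrite -aE leNgt; apply/negP => /ltW q.
have [us s0 sn opt] := optS n0.
have at0 : 0 < a * tau n by rewrite mulr_gt0.
have := err_gain hN hr fm s0 (y := y) (t := a * tau n).
rewrite q (ltW at0) -/g => /(_ isT) gain.
have at4 : 0 <= a * tau n / 4 <= eps.
  rewrite divr_ge0 ?(ltW at0)//=.
  have : a * tau n <= eps by rewrite mulrC -ler_pdivlMr.
  exact: quarter_le.
have Pb : m * (w * (a * tau n / 4) ^+ d) <= fine (P (nball N y (a * tau n / 4))).
  rewrite -lee_fin fine_prob; last exact: measurable_nball.
  apply: le_trans (HY _ _ Yy at4); rewrite EFinM lee_wpmul2l ?lee_fin ?(ltW m0)//.
  by apply: wt; have /andP[] := at4.
have [_ _ _ optS1] := optS (ltn0Sn n).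
have e1 := optS1 (y :: S n) isT sn.
have e2 := HC n n1n.
have gt0' : 0 <= g * (a * tau n) `^ r by rewrite mulr_ge0 ?powR_ge0 ?(ltW g0).
have := ler_wpM2l gt0' Pb.
rewrite [X in X <= _ -> _](_ : _ = 2 * (C * (tau n `^ r / n%:R))).
  apply: (increment_absurd gain e1 e2).
  by rewrite !mulr_gt0 ?powR_gt0 ?invr_gt0 ?ltr0n.
rewrite powRM ?(ltW a0) ?(ltW tn0)// !exprMn (tauX R hd).
rewrite [LHS](_ : _ = (a `^ r * a ^+ d) * m * (g * w * 4^-1 ^+ d) * (tau n `^ r / n%:R)).
  by rewrite ard -BE; field; rewrite (gt_eqF B0) (gt_eqF m0) pnatr_eq0 -lt0n n0.
ring.
Qed.

(** A cell meeting K, when the codebook is rho-dense near K and rho is small. *)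
Section around.
Context (K : set 'rV[R]_d) (eps M : R).
Context (eps0 : 0 < eps) (M0 : 0 < M).
Let Ke : set 'rV[R]_d := [set y | exists2 k, K k & N (y - k) <= eps].
Context (PM : forall E, measurable E -> E `<=` Ke -> (P E <= M%:E * lam E)%E).

Context (n : nat) (rho : R) (rho0 : 0 < rho) (n0 : (0 < n)%N).
Context (rho_eps : 6 * rho <= eps).
Context (cover : forall y k,
  K k -> N (y - k) <= eps / 2 -> qdist N (S n) y <= rho).
Context (a : 'rV[R]_d) (ha : near_codebook N [set` S n] K a).

Let us : uniq (S n). Proof. by have [] := optS n0. Qed.
Let s0 : S n != [::]. Proof. by have [] := optS n0. Qed.
Let sa : a \in S n. Proof. by have [] := ha. Qed.

Let center : exists2 k, K k & N (k - a) <= rho.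
Proof.
have [_ [k [+ Kk]]] := ha; rewrite voronoi_seqE// => /= kE; exists k => //.
by rewrite kE; apply: (cover Kk); rewrite subrr norm0// divr_ge0// ltW.
Qed.

Lemma voronoi_sub_nball : voronoi N [set` S n] a `<=` nball N a rho.
Proof.
have [k Kk ka] := center.
rewrite voronoi_seqE// => x /= xa; rewrite /nball /= leNgt; apply/negP => rx.
(* If x is too far from a, the cell contains a point z at distance l > rho from a
   that is still close to K, against the density of the codebook. *)
set l := Num.min (N (x - a)) (2 * rho).
have l1 : rho < l by rewrite lt_min rx lt_double.
have l2 : l <= 2 * rho by rewrite ge_min lexx orbT.
have Nx0 : 0 < N (x - a) by exact: lt_trans rx.
have lx : 0 <= l / N (x - a) <= 1.
  rewrite divr_ge0 ?(ltW Nx0) ?(le_trans (ltW rho0) (ltW l1))//=.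
  by rewrite ler_pdivrMr// mul1r ge_min lexx.
have := voronoi_star hN sa xa lx; rewrite divfK ?gt_eqF//.
set z := a + _ => qz.
have za : N (z - a) = l.
  rewrite /z addrAC subrr add0r (normZ hN) ger0_norm; last by have /andP[] := lx.
  by rewrite divfK// gt_eqF.
have zk : N (z - k) <= eps / 2.
  apply: (half_of_sixth rho_eps l2 ka).
  by have := normBD hN a z k; rewrite za (normBC hN a k).
by have := cover Kk zk; rewrite qz leNgt l1.
Qed.

(** The codebook has a point within rho of a point at distance exactly 2 * rho from a;
    it is therefore not a. *)
Lemma voronoi_neighbour : exists2 b, b \in rem a (S n) & N (a - b) <= 3 * rho.
Proof.
have [k Kk ka] := center; have [e Ne] := unit_vector hN hd.
set z := a + (2 * rho) *: e.
have r2 : 0 <= 2 * rho by rewrite mulr_ge0// ltW.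
have za : N (z - a) = 2 * rho.
  by rewrite /z addrAC subrr add0r (normZ hN) ger0_norm// Ne mulr1.
have zk : N (z - k) <= eps / 2.
  apply: (half_of_sixth rho_eps (lexx _) ka).
  by have := normBD hN a z k; rewrite za (normBC hN a k).
have := cover Kk zk; have [b sb ->] := qdist_attained N z s0 => zb.
exists b.
  rewrite mem_rem_uniq// !inE sb andbT; apply/eqP => ba.
  by move: zb; rewrite ba za leNgt lt_double.
rewrite (le_trans (normBD hN z a b))// (normBC hN a z) za.
have -> : 3 * rho = 2 * rho + rho by ring.
by rewrite lerD2l.
Qed.

Let rem0 : rem a (S n) != [::].
Proof. by have [b rb _] := voronoi_neighbour; apply: contraTneq rb => ->. Qed.

Lemma open_voronoi_sub : open_voronoi N [set` S n] a `<=` voronoi N [set` S n] a.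
Proof.
by rewrite open_voronoi_seqE// voronoi_seqE// => x; exact: qdist_rem_cell.
Qed.

Let mV : measurable (voronoi N [set` S n] a).
Proof. exact: measurable_voronoi. Qed.

Let mV0 : measurable (open_voronoi N [set` S n] a).
Proof. exact: measurable_open_voronoi. Qed.

Lemma nball_sub_Ke : nball N a rho `<=` Ke.
Proof.
have [k Kk ka] := center => x xa; exists k => //.
have x2 : N (x - a) <= 2 * rho by rewrite (le_trans xa)// ltW// lt_double.
have H : N (x - k) <= N (x - a) + N (k - a).
  by have := normBD hN a x k; rewrite (normBC hN a k).
rewrite (le_trans (half_of_sixth rho_eps x2 ka H))// ler_pdivrMr// ler_peMr// ?ltW//.
by rewrite ltr1n.
Qed.

Lemma voronoi_prob_le (w : R) :
  (forall a t, 0 <= t -> (lam (nball N a t) <= (w * t ^+ d)%:E)%E) ->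
  (P (voronoi N [set` S n] a) <= (M * (w * rho ^+ d))%:E)%E.
Proof.
move=> wt; apply: (@le_trans _ _ (P (nball N a rho))).
  apply: le_measure; rewrite ?inE//; first exact: measurable_nball.
  exact: voronoi_sub_nball.
apply: (le_trans (PM (measurable_nball hN a rho) nball_sub_Ke)).
by rewrite EFinM lee_wpmul2l ?lee_fin ?(ltW M0) ?wt ?(ltW rho0).
Qed.

Lemma measurable_inertia (E : set 'rV[R]_d) :
  measurable_fun E (fun x => (N (x - a) `^ r)%:E).
Proof.
apply/measurable_EFinP; apply: measurable_funTS.
exact: measurableT_comp (measurable_powR r) (measurable_normB hN a).
Qed.

Lemma voronoi_inertia_le :
  (local_inertia N r P (voronoi N [set` S n] a) a <=
   (rho `^ r)%:E * P (voronoi N [set` S n] a))%E.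
Proof.
rewrite /local_inertia -integral_cst//; apply: ge0_le_integral => //.
- by move=> x _; rewrite lee_fin powR_ge0.
- exact: measurable_inertia.
- move=> x /voronoi_sub_nball xa; rewrite lee_fin.
  by apply: (ge0_ler_powR (ltW hr)); rewrite ?nnegrE ?norm_ge0 ?(ltW rho0).
Qed.

(** Deleting a costs at most (4 * rho)^r on its open cell and nothing elsewhere, but
    at least the lower bound on the increments. *)
Lemma open_voronoi_prob_ge (c : R) :
  (forall n s', (0 < n)%N -> s' != [::] -> (size s' <= n.-1)%N ->
    err (S n) + c * (tau n `^ r / n%:R) <= err s') ->
  c * (tau n `^ r / n%:R) <= (4 * rho) `^ r * fine (P (open_voronoi N [set` S n] a)).
Proof.
move=> Hc; have [_ _ sn _] := optS n0.
have srem : (size (rem a (S n)) <= n.-1)%N by rewrite size_rem// -!subn1 leq_sub2r.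
have Hrem := Hc n (rem a (S n)) n0 rem0 srem.
have [b rb ab] := voronoi_neighbour.
suff : err (rem a (S n)) <= err (S n) +
    (4 * rho) `^ r * fine (P (open_voronoi N [set` S n] a)).
  by move=> /(le_trans Hrem); rewrite lerD2l.
apply: (err_indic_le hN hr fm mV0 (powR_ge0 _ _)) => x.
rewrite indicE; case: (boolP (x \in open_voronoi _ _ _)) => [/set_mem Vx|].
  rewrite mulr1 -[leLHS]add0r lerD ?powR_ge0//.
  apply: (ge0_ler_powR (ltW hr)); rewrite ?nnegrE ?qdist_ge0//.
    by rewrite mulr_ge0// ltW.
  apply: (le_trans (qdist_le N x rb)); apply: (le_trans (normBD hN a x b)).
  have -> : 4 * rho = rho + 3 * rho by ring.
  apply: lerD ab.
  exact: (voronoi_sub_nball (open_voronoi_sub Vx)).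
rewrite notin_setE open_voronoi_seqE// => /negP; rewrite -leNgt => Vx.
rewrite mulr0 addr0; apply: (ge0_ler_powR (ltW hr)); rewrite ?nnegrE ?qdist_ge0//.
exact: (qdist_rem_off_cell us sa Vx).
Qed.

(** The open cell has mass at least 2 * q and the ball of radius t about a takes at
    most q of it, so mass at least q lies at distance more than t from a. *)
Lemma open_voronoi_inertia_ge (w t q : R) : 0 <= t -> 0 <= q ->
  (forall a t, 0 <= t -> (lam (nball N a t) <= (w * t ^+ d)%:E)%E) ->
  M * (w * t ^+ d) <= q -> 2 * q <= fine (P (open_voronoi N [set` S n] a)) ->
  ((t `^ r * q)%:E <= local_inertia N r P (open_voronoi N [set` S n] a) a)%E.
Proof.
move=> t0 q0 wt Mq qP.
set V := open_voronoi _ _ _ in qP *.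
set B := nball N a t.
have mB : measurable B by exact: measurable_nball.
have mVB : measurable (V `&` B) by exact: measurableI.
have mVDB : measurable (V `\` B) by exact: measurableD.
have VKe : V `<=` Ke.
  by move=> x /open_voronoi_sub /voronoi_sub_nball; exact: nball_sub_Ke.
have PVB : fine (P (V `&` B)) <= q.
  rewrite (le_trans _ Mq)// -lee_fin fine_prob//.
  apply: (@le_trans _ _ (M%:E * lam (V `&` B))%E).
    by apply: PM => // x [/VKe].
  rewrite EFinM lee_wpmul2l ?lee_fin ?(ltW M0)//.
  apply: le_trans (wt a t t0); apply: le_measure; rewrite ?inE//.
have PVDB : q <= fine (P (V `\` B)).
  have : fine (P V) = fine (P (V `\` B)) + fine (P (V `&` B)).
    by apply/EFin_inj; rewrite EFinD !fine_prob// -measureDI.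
  move=> E; move: qP; rewrite E mulr_natl mulr2n => qP.
  by rewrite -(lerD2r q) (le_trans qP)// lerD2l.
apply: (@le_trans _ _ (local_inertia N r P (V `\` B) a)); last first.
  apply: ge0_subset_integral => //; first exact: measurable_inertia.
  by move=> x _; rewrite lee_fin powR_ge0.
apply: (@le_trans _ _ ((t `^ r)%:E * P (V `\` B))%E).
  by rewrite EFinM lee_wpmul2l ?lee_fin ?powR_ge0// -fine_prob// lee_fin.
rewrite /local_inertia -integral_cst//; apply: ge0_le_integral => //.
- by move=> x _; rewrite lee_fin powR_ge0.
- exact: measurable_inertia.
- move=> x [_ /negP]; rewrite /B /nball /= -ltNge => /ltW tx; rewrite lee_fin.
  by apply: (ge0_ler_powR (ltW hr)); rewrite ?nnegrE ?norm_ge0.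
Qed.

End around.
End local_bounds.

(** * Local bounds with explicit exponents *)

Section exponents.
Context {R : realType} (d : nat) (hd : (0 < d)%N) (r : R) (hr : 0 < r).
Local Notation D := (d%:R : R).

Let D0 : 0 < D. Proof. by rewrite ltr0n. Qed.
Let rD : 0 < r + D. Proof. by rewrite addr_gt0. Qed.

(** The factor m^(-1/(r+d)) is the dependence on m of the covering radius. *)
Lemma rad_exprd (m : R) :
  (m `^ (- (r + D)^-1)) ^+ d = (m `^ (D / (r + D)))^-1.
Proof.
by rewrite -powR_mulrn ?powR_ge0// -powRrM mulNr mulrC powRN.
Qed.

Lemma rad_powr (m : R) :
  (m `^ (- (r + D)^-1)) `^ r = (m `^ (r / (r + D)))^-1.
Proof. by rewrite -powRrM mulNr mulrC powRN. Qed.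

Lemma rad_powrd (m : R) : 0 < m ->
  (m `^ (- (r + D)^-1)) `^ r * (m `^ (- (r + D)^-1)) ^+ d = m^-1.
Proof.
move=> m0; rewrite rad_exprd rad_powr -invfM -powRD; last by rewrite (gt_eqF m0) implybT.
by rewrite -mulrDl divff ?gt_eqF// powRr1// ltW.
Qed.

Lemma ratio_powr (m M : R) : 0 < m -> 0 < M ->
  (m `^ (r / (r + D)) / M) `^ (r / D) * m `^ (r / (r + D)) = (m / M) `^ (r / D).
Proof.
move=> m0 M0; have M0' : 0 <= M^-1 by rewrite invr_ge0 ltW.
rewrite powRM ?powR_ge0// [RHS]powRM ?(ltW m0)// mulrAC; congr (_ * _).
rewrite -powRrM -powRD; last by rewrite (gt_eqF m0) implybT.
by congr (_ `^ _); field; rewrite (gt_eqF D0) (gt_eqF rD).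
Qed.

End exponents.

Section local_theorem.
Context (R : realType) (d : nat) (hd : (0 < d)%N).
Context (N : 'rV[R]_d -> R) (hN : is_norm N) (r : R) (hr : 0 < r).
Context (P : probability 'rV[R]_d R) (h : 'rV[R]_d -> R) (hPh : is_density P h).
Context (delta : R) (delta0 : 0 < delta).
Context (hmoment : (\int[P]_x (N x `^ (r + delta))%:E < +oo)%E).
Context (S : nat -> seq 'rV[R]_d).
Context (optS : forall n, (0 < n)%N -> optimal_seq N r P n (S n)).

Local Notation lam := (lebesgue_rV R d).
Local Notation tau := (tau R d).
Local Notation D := (d%:R : R).

(** All four bounds for a single cell meeting K, when P is comparable to Lebesgue
    measure near K with ratios between m and M. *)
Lemma local_cell_bounds : exists c1 c2 c3 c4 : R,
  [/\ 0 < c1, 0 < c2, 0 < c3 & 0 < c4] /\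
  forall (K : set 'rV[R]_d) (eps m M : R), 0 < eps -> 0 < m -> 0 < M ->
  (forall E, measurable E -> E `<=` [set y | exists2 k, K k & N (y - k) <= eps] ->
    (P E <= M%:E * lam E)%E) ->
  (forall E, measurable E -> E `<=` [set y | exists2 k, K k & N (y - k) <= eps] ->
    (m%:E * lam E <= P E)%E) ->
  exists n0 : nat, forall n a, (n0 <= n)%N -> near_codebook N [set` S n] K a ->
  [/\ (0 < n)%N /\
      (n%:R%:E * P (voronoi N [set` S n] a) <=
       (c1 * (M / m `^ (D / (r + D))))%:E)%E,
      ((n%:R `^ (1 + r / D))%:E * local_inertia N r P (voronoi N [set` S n] a) a
       <= (c2 * (M / m))%:E)%E,
      ((c3 * m `^ (r / (r + D)))%:E <=
       n%:R%:E * P (open_voronoi N [set` S n] a))%E &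
      ((c4 * (m / M) `^ (r / D))%:E <= (n%:R `^ (1 + r / D))%:E *
         local_inertia N r P (open_voronoi N [set` S n] a) a)%E].
Proof.
have [G G0 HG] := qdist_small hd hN hr hPh delta0 hmoment optS.
have [w w0 wt] := lebesgue_nball_le hN.
have [c c0 Hc] := err_decrement_ge hd hN hr hPh delta0 hmoment optS.
have D0 : 0 < D by rewrite ltr0n.
have [c1 c10 c1E] : exists2 c1, 0 < c1 & c1 = w * G ^+ d.
  by exists (w * G ^+ d) => //; rewrite mulr_gt0 ?exprn_gt0.
have [c3 c30 c3E] : exists2 c3, 0 < c3 & c3 = c / (4 `^ r * G `^ r).
  by exists (c / (4 `^ r * G `^ r)) => //; rewrite divr_gt0 ?mulr_gt0 ?powR_gt0.
have c20 : 0 < c1 * G `^ r by rewrite mulr_gt0 ?powR_gt0.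
have c40 : 0 < (c3 / (2 * w)) `^ (r / D) * (c3 / 2).
  by rewrite mulr_gt0 ?powR_gt0 ?divr_gt0 ?mulr_gt0.
exists c1, (c1 * G `^ r), c3, ((c3 / (2 * w)) `^ (r / D) * (c3 / 2)).
split; first by [].
move=> K eps m M eps0 m0 M0 PM Pm.
set b := m `^ (- (r + D)^-1).
have b0 : 0 < b by exact: powR_gt0.
have bd : b ^+ d = (m `^ (D / (r + D)))^-1 by exact: rad_exprd.
have br : b `^ r = (m `^ (r / (r + D)))^-1 by exact: rad_powr.
have brd : b `^ r * b ^+ d = m^-1 by exact: rad_powrd.
set e := m `^ (r / (r + D)) in br *.
have e0 : 0 < e by exact: powR_gt0.
have Gb0 : 0 < G * b by exact: mulr_gt0.
have eps2 : 0 < eps / 2 by exact: divr_gt0.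
have [|n1 H1] := HG m (eps / 2) [set y | exists2 k, K k & N (y - k) <= eps / 2] m0 eps2.
  move=> y t [k Kk yk] /andP[t0 te]; apply: Pm; first exact: measurable_nball.
  move=> x xy; exists k => //; rewrite (le_trans (normBD hN y x k))//.
  by rewrite [leRHS]splitr lerD// (le_trans xy).
have [n2 H2] := tau_small hd (divr_gt0 eps0 (mulr_gt0 (ltr0n R 6) Gb0)).
exists (maxn 1 (maxn n1 n2)) => n a; rewrite !geq_max.
move=> /and3P[n0 /H1 {}H1 /H2 {}H2] ha.
have n0' : 0 < n%:R :> R by rewrite ltr0n.
have tn0 := tau_gt0 R d n0.
set rho := G * b * tau n in H1.
have rho0 : 0 < rho by exact: mulr_gt0.
have rho_eps : 6 * rho <= eps.
  by move: H2; rewrite ler_pdivlMr ?(mulr_gt0 _ Gb0)// mulrC -mulrA.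
have cover y k : K k -> N (y - k) <= eps / 2 -> qdist N (S n) y <= rho.
  by move=> Kk yk; apply: H1; exists k.
have sizen := tau_powR d r n0.
have n1r : 0 <= n%:R `^ (1 + r / D) :> R by exact: powR_ge0.
have B1 := voronoi_prob_le hN optS eps0 M0 PM rho0 n0 rho_eps cover ha wt.
have B2 := voronoi_inertia_le hN hr optS eps0 rho0 n0 rho_eps cover ha.
have B3 := open_voronoi_prob_ge hd hN hr delta0 hmoment optS eps0 rho0 n0
  rho_eps cover ha Hc.
have B4 := open_voronoi_inertia_ge hd hN hr optS eps0 M0 PM rho0 n0 rho_eps
  cover ha.
have rhod : rho ^+ d = (G * b) ^+ d / n%:R by rewrite exprMn (tauX R hd).
have Gbd : (G * b) ^+ d = G ^+ d * b ^+ d by rewrite exprMn.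
have Gbr : (G * b) `^ r = G `^ r * b `^ r by rewrite powRM ?(ltW G0) ?(ltW b0).
have rhor : rho `^ r = (G * b) `^ r * tau n `^ r.
  by rewrite [LHS]powRM ?(ltW Gb0) ?(ltW tn0).
have [us s0 _ _] := optS n0.
set V := voronoi N [set` S n] a in B1 B2 *.
set W := open_voronoi N [set` S n] a in B3 B4 *.
have q0 : 0 < c3 * e by exact: mulr_gt0.
have pW : c3 * e / n%:R <= fine (P W).
  have x0 : 0 < 4 `^ r * (G * b) `^ r * tau n `^ r.
    by rewrite !mulr_gt0 ?powR_gt0.
  rewrite -(ler_pM2l x0); apply: le_trans (le_trans B3 _).
    rewrite c3E Gbr br le_eqVlt; apply/orP; left; apply/eqP.
    by field; rewrite !gt_eqF ?powR_gt0.
  by rewrite [(4 * rho) `^ r]powRM ?(ltW rho0)// rhor mulrA.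
have PWge : ((c3 * e / n%:R)%:E <= P W)%E.
  rewrite (le_trans (_ : _ <= (fine (P W))%:E)%E) ?lee_fin//.
  have [k rb _] := voronoi_neighbour hd hN optS eps0 rho0 n0 rho_eps cover ha.
  rewrite fine_prob//; apply: measurable_open_voronoi => //.
  by apply: contraTneq rb => ->.
split.
- split; first exact: n0.
  apply: (@le_trans _ _ (n%:R%:E * (M * (w * rho ^+ d))%:E)%E).
    by rewrite lee_pmul2l ?lte_fin.
  rewrite -EFinM lee_fin rhod Gbd bd c1E le_eqVlt; apply/orP; left; apply/eqP.
  by field; rewrite !gt_eqF ?powR_gt0.
- apply: (@le_trans _ _ ((n%:R `^ (1 + r / D))%:E *
      (rho `^ r * (M * (w * rho ^+ d)))%:E)%E).
    rewrite lee_wpmul2l ?lee_fin//; apply: (le_trans B2).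
    by rewrite EFinM lee_wpmul2l ?lee_fin ?powR_ge0.
  rewrite -EFinM lee_fin.
  rewrite [leLHS](_ : _ = M * w * ((G * b) `^ r * (G * b) ^+ d) *
     (n%:R `^ (1 + r / D) * (tau n `^ r / n%:R))); last by rewrite rhor rhod; ring.
  have -> : (G * b) `^ r * (G * b) ^+ d = G `^ r * G ^+ d * m^-1.
    by rewrite Gbr Gbd mulrACA brd.
  rewrite sizen mulr1 c1E le_eqVlt.
  by apply/orP; left; apply/eqP; ring.
- apply: (@le_trans _ _ (n%:R%:E * (c3 * e / n%:R)%:E)%E).
    rewrite -EFinM lee_fin le_eqVlt; apply/orP; left; apply/eqP.
    by field; rewrite !gt_eqF.
  by rewrite lee_pmul2l ?lte_fin.
- (* the ball of radius u * tau(n) has mass at most half the bound on P(W) *)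
  pose u := (c3 * e / (2 * (M * w))) `^ D^-1.
  have Mw0 : 0 < M * w by exact: mulr_gt0.
  have u00 : 0 < c3 * e / (2 * (M * w)) by rewrite divr_gt0// mulr_gt0.
  have u0 : 0 < u by exact: powR_gt0.
  have ud : u ^+ d = c3 * e / (2 * (M * w)).
    by rewrite -powR_mulrn ?(ltW u0)// -powRrM mulVf ?gt_eqF// powRr1// ltW.
  have ur : u `^ r = (c3 / (2 * w)) `^ (r / D) * (e / M) `^ (r / D).
    rewrite -powRM ?divr_ge0 ?(ltW c30) ?(ltW e0) ?(ltW M0)//; last first.
      by rewrite mulr_ge0// ltW.
    rewrite /u -powRrM [D^-1 * r]mulrC; congr (_ `^ _).
    by field; rewrite !gt_eqF.
  have := B4 w (u * tau n) (c3 * e / n%:R / 2).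
  move=> /(_ _ _ wt) H.
  have {}H : (((u * tau n) `^ r * (c3 * e / n%:R / 2))%:E <= local_inertia N r P W a)%E.
    apply: H.
    + by rewrite mulr_ge0 ?(ltW u0) ?(ltW tn0).
    + by rewrite !divr_ge0 ?(ltW q0).
    + rewrite exprMn (tauX R hd) ud le_eqVlt; apply/orP; left; apply/eqP.
      by field; rewrite !gt_eqF.
    + apply: le_trans pW; rewrite le_eqVlt; apply/orP; left; apply/eqP.
      by field; rewrite !gt_eqF.
  apply: (@le_trans _ _ ((n%:R `^ (1 + r / D))%:E *
      ((u * tau n) `^ r * (c3 * e / n%:R / 2))%:E)%E); last first.
    by rewrite lee_wpmul2l ?lee_fin.
  rewrite -EFinM lee_fin [(u * tau n) `^ r]powRM ?(ltW u0) ?(ltW tn0)//.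
  rewrite [leRHS](_ : _ = u `^ r * (c3 * e / 2) *
     (n%:R `^ (1 + r / D) * (tau n `^ r / n%:R))); last by ring.
  rewrite sizen mulr1 -(ratio_powr hd hr m0 M0) -/e ur le_eqVlt.
  by apply/orP; left; apply/eqP; ring.
Qed.

End local_theorem.

(** * Limits and essential bounds in the extended reals *)

Section extended_reals.
Context {R : realType}.
Local Open Scope ereal_scope.
Implicit Types (u : nat -> \bar R) (x y : \bar R).

Lemma limn_esup_le_near u x :
  (exists n0, forall n, (n0 <= n)%N -> u n <= x) -> limn_esup u <= x.
Proof.
move=> [n0 H]; apply: ge_ereal_inf => /=.
exists (ereal_sup [set u n | n in [set n | (n0 <= n)%N]]).
  by exists [set n | (n0 <= n)%N] => //; exact: nbhs_infty_ge.
by apply: ge_ereal_sup => _ [n /= nn <-]; exact: H.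
Qed.

Lemma limn_einf_ge_near u x :
  (exists n0, forall n, (n0 <= n)%N -> x <= u n) -> x <= limn_einf u.
Proof.
move=> [n0 H]; rewrite /limn_einf leeNr; apply: limn_esup_le_near.
by exists n0 => n nn; rewrite leeN2; exact: H.
Qed.

Lemma pmul_ereal_inf_ge (c : R) (I : Type) (f : I -> \bar R) (A : set I) x :
  (0 < c)%R -> (forall i, A i -> x <= c%:E * f i) ->
  x <= c%:E * ereal_inf [set f i | i in A].
Proof.
move=> c0 H; rewrite -lee_pdivrMl//; apply: le_ereal_inf_tmp => _ [i Ai <-].
by rewrite lee_pdivrMl//; exact: H.
Qed.

Lemma pmul_ereal_sup_le (c : R) (I : Type) (f : I -> \bar R) (A : set I) x :
  (0 < c)%R -> (forall i, A i -> c%:E * f i <= x) ->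
  c%:E * ereal_sup [set f i | i in A] <= x.
Proof.
move=> c0 H; rewrite -lee_pdivlMl//; apply: ge_ereal_sup => _ [i Ai <-].
by rewrite lee_pdivlMl//; exact: H.
Qed.

Lemma EFin_div (a b : R) : b != 0%R -> a%:E / b%:E = (a / b)%:E.
Proof. by move=> b0; rewrite /inve (negbTE b0). Qed.

Lemma gt0_dive0 x : 0 < x -> x / 0 = +oo.
Proof. by move=> x0; rewrite inve0 gt0_muley. Qed.

Lemma dive_y x : x / +oo = 0.
Proof. by rewrite /inve mule0. Qed.

Lemma divye (b : R) : (0 < b)%R -> +oo / b%:E = +oo.
Proof. by move=> b0; rewrite /inve gt_eqF// gt0_mulye// lte_fin invr_gt0. Qed.

End extended_reals.

Section essential_bounds.
Context (R : realType) (d : nat) (hd : (0 < d)%N).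
Context (N : 'rV[R]_d -> R) (hN : is_norm N).
Context (P : probability 'rV[R]_d R) (h : 'rV[R]_d -> R) (hPh : is_density P h).
Context (K : set 'rV[R]_d) (eps : R) (eps0 : 0 < eps).
Local Notation lam := (lebesgue_rV R d).
Local Notation hsup := (ess_sup_on lam (thickening N K eps) h).
Local Notation hinf := (ess_inf_on lam (thickening N K eps) h).
Local Notation Ke := [set y | exists2 k, K k & N (y - k) <= eps].

(** The reverse inclusion also holds for compact K but plays no role. *)
Lemma sub_thickening : Ke `<=` thickening N K eps.
Proof.
move=> y [k Kk yk]; rewrite /thickening /=.
apply: (@le_trans _ _ (N (y - k))%:E); last by rewrite lee_fin.
by apply: ereal_inf_lbound; exists k.
Qed.

(** An upper bound on the essential supremum bounds P on sets near K. *)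
Lemma prob_le_ess_sup (M : R) E : 0 <= M -> (hsup <= M%:E)%E -> measurable E ->
  E `<=` Ke -> (P E <= M%:E * lam E)%E.
Proof.
move=> M0 hM mE EK; apply: (density_le hPh mE M0).
have /ess_supP : (hsup <= M%:E)%E := hM.
apply: filterS => x; rewrite /patch => Hx Ex.
move: Hx; rewrite mem_set; last exact/sub_thickening/EK.
by rewrite /= lee_fin.
Qed.

Lemma prob_ge_ess_inf (m : R) E : 0 <= m -> (m%:E <= hinf)%E -> measurable E ->
  E `<=` Ke -> (m%:E * lam E <= P E)%E.
Proof.
move=> m0 hm mE EK; apply: (density_ge hPh mE m0).
have /ess_infP : (m%:E <= hinf)%E := hm.
apply: filterS => x; rewrite /patch => Hx Ex.
move: Hx; rewrite mem_set; last exact/sub_thickening/EK.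
by rewrite /= lee_fin.
Qed.

Lemma ess_inf_ge0 : (0 <= hinf)%E.
Proof.
have [_ h0 _] := hPh.
apply/ess_infP; apply: nearW => x; rewrite /patch.
by case: ifPn => _ /=; rewrite ?leey// lee_fin.
Qed.

Context (k : 'rV[R]_d) (Kk : K k).

Let nball_sub : nball N k eps `<=` Ke.
Proof. by move=> x xk; exists k. Qed.

Lemma lebesgue_nball_bounds : exists2 v : R, 0 < v & lam (nball N k eps) = v%:E.
Proof.
have [w w0 wt] := lebesgue_nball_le hN.
have [w' w'0 wt'] := lebesgue_nball_ge hN.
have := wt k eps (ltW eps0); have := wt' k eps (ltW eps0).
case: (lam _) => [v| |] //; rewrite !lee_fin => ge _; exists v => //.
by apply: lt_le_trans ge; rewrite mulr_gt0 ?exprn_gt0.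
Qed.

Lemma ess_inf_lty : (hinf < +oo)%E.
Proof.
rewrite ltey; apply/eqP => hy.
have [v v0 vE] := lebesgue_nball_bounds.
have v2 : 0 <= 2 / v by rewrite divr_ge0// ltW.
have := @prob_ge_ess_inf (2 / v) (nball N k eps) v2.
rewrite hy leey => /(_ isT (measurable_nball hN k eps) nball_sub).
rewrite vE -EFinM divfK ?gt_eqF//.
move=> /le_trans/(_ (probability_le1 P (measurable_nball hN k eps))).
by rewrite lee_fin leNgt ltr1n.
Qed.

Lemma ess_inf_le_sup (m M : R) : 0 <= m -> 0 <= M ->
  (m%:E <= hinf)%E -> (hsup <= M%:E)%E -> m <= M.
Proof.
move=> m0 M0 hm hM; have [v v0 vE] := lebesgue_nball_bounds.
have mB := measurable_nball hN k eps.
have := le_trans (prob_ge_ess_inf m0 hm mB nball_sub)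
  (prob_le_ess_sup M0 hM mB nball_sub).
by rewrite vE -!EFinM lee_fin ler_pM2r.
Qed.

(** Here it matters that K lies in the support of P. *)
Lemma ess_sup_gt0 : supp P k -> (0 < hsup)%E.
Proof.
move=> Pk; rewrite ltNge; apply/negP => hs.
have mB := measurable_nball hN k eps.
have PB := prob_le_ess_sup (lexx 0) hs mB nball_sub.
pose U : set 'rV[R]_d := [set x | N (x - k) < eps].
have oU : open U.
  rewrite (_ : U = (fun x => N (x - k)) @^-1` [set x | x < eps])//.
  apply: open_comp; last exact: open_lt.
  move=> x _; apply: (lipschitz_continuous hN) => {}x y.
  by rewrite (le_trans (normB_dist hN _ _))// opprB addrA subrK.
have : (0 < P U)%E by apply: Pk; split => //; rewrite /U /= subrr norm0.
rewrite ltNge => /negP; apply.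
rewrite mul0e in PB; apply: le_trans PB; apply: le_measure; rewrite ?inE//.
  exact: sub_sigma_algebra.
by move=> x /ltW.
Qed.

End essential_bounds.

(** * Asymptotics of the extreme cells *)

Theorem theorem5p1 (R : realType) (d : nat) (hd : (0 < d)%N)
  (N : 'rV[R]_d -> R) (hN : is_norm N)
  (r : R) (hr : 0 < r)
  (P : probability 'rV[R]_d R) (h : 'rV[R]_d -> R) (hPh : is_density P h)
  (hmoment : exists2 delta : R, 0 < delta &
     (\int[P]_x (N x `^ (r + delta))%:E < +oo)%E)
  (alpha : nat -> set 'rV[R]_d)
  (halpha : forall n, (0 < n)%N -> optimal_codebook N r P n (alpha n)) :
  exists c27 c28 c31 c32 c33 c34 : R,
    [/\ 0 < c27, 0 < c28 & 0 < c31] /\ [/\ 0 < c32, 0 < c33 & 0 < c34] /\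
    forall K : set 'rV[R]_d, K !=set0 -> compact K ->
      K `<=` interior (supp P) ->
      let hsup e := ess_sup_on (lebesgue_rV R d) (thickening N K e) h in
      let hinf e := ess_inf_on (lebesgue_rV R d) (thickening N K e) h in
      let pos := [set e : R | 0 < e] in
      let D := d%:R : R in
      [/\ (limn_esup (fun n => n%:R%:E *
               ereal_sup [set P (voronoi N (alpha n) a)
                         | a in near_codebook N (alpha n) K])
           <= c27%:E *
              ereal_inf [set hsup e / (hinf e `^ (D / (r + D))) | e in pos])%E,
          (limn_esup (fun n => (n%:R `^ (1 + r / D))%:E *
               ereal_sup [set local_inertia N r P (voronoi N (alpha n) a) a
                         | a in near_codebook N (alpha n) K])
           <= c28%:E * ereal_inf [set hsup e / hinf e | e in pos])%E,
          ((if (1 <= r)%R then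
              c31%:E * ereal_sup [set (hinf e / hsup e) `^ D *
                                      hinf e `^ (r / (r + D)) | e in pos]
            else
              c32%:E * ereal_sup [set (hinf e / hsup e) `^ (D / r) *
                                      hinf e `^ (r / (r + D)) | e in pos])
           <= limn_einf (fun n => n%:R%:E *
                ereal_inf [set P (open_voronoi N (alpha n) a)
                          | a in near_codebook N (alpha n) K]))%E &
          ((if (1 <= r)%R then
              c33%:E *
              ereal_sup [set (hinf e / hsup e) `^ (r + D) | e in pos]
            else
              c34%:E *
              ereal_sup [set (hinf e / hsup e) `^ (1 + D / r) | e in pos])
           <= limn_einf (fun n => (n%:R `^ (1 + r / D))%:E *
                ereal_inf [set local_inertia N r P (open_voronoi N (alpha n) a) a
                          | a in near_codebook N (alpha n) K]))%E].
Proof.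
have [delta delta0 hm] := hmoment.
have fm := finite_moment hN hr delta0 hm.
have /choice[S HS] n : exists s, (0 < n)%N ->
    alpha n = [set` s] /\ optimal_seq N r P n s.
  case: n => [|n]; first by exists [::].
  have [s sE os] := optimal_codebook_seq hN hr fm (ltn0Sn n) (halpha _ (ltn0Sn n)).
  by exists s.
have optS n (n0 : (0 < n)%N) := (HS n n0).2.
have [c1 [c2 [c3 [c4 [[c10 c20 c30 c40] HB]]]]] :=
  local_cell_bounds hd hN hr hPh delta0 hm optS.
exists c1, c2, c3, c3, c4, c4; split; [by split|split; [by split|]].
move=> K [k Kk] _ Ksupp hsup hinf pos D.
have D0 : 0 < D by rewrite ltr0n.
have D1 : 1 <= D by rewrite ler1n.
have rD : 0 < r + D by exact: addr_gt0.
have Pk : supp P k by apply: (@interior_subset _ (supp P)); exact: Ksupp.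
have hcases e : pos e -> [\/ hinf e = 0%E /\ (0 < hsup e)%E,
    (exists2 m, 0 < m & hinf e = m%:E) /\ hsup e = +oo%E |
    exists m M, [/\ 0 < m, 0 < M, hinf e = m%:E & hsup e = M%:E]].
  move=> e0; have hs := ess_sup_gt0 hN hPh e0 Kk Pk.
  have hi := ess_inf_ge0 N hPh K e.
  have hiy := ess_inf_lty hN hPh e0 Kk.
  rewrite -/(hsup e) -/(hinf e) in hs hi hiy *.
  move: hi hiy; case hiE : (hinf e) => [m| |]// + _.
  rewrite lee_fin le_eqVlt => /predU1P[<-|m0]; first by apply: Or31.
  move: hs; case hsE : (hsup e) => [M| |]// hs.
    by apply: Or33; exists m, M.
  by apply: Or32; split => //; exists m.
have hbounds e m M : pos e -> 0 < m -> 0 < M -> hinf e = m%:E -> hsup e = M%:E ->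
  m <= M /\ exists n0 : nat, forall n a, (n0 <= n)%N -> (0 < n)%N ->
  near_codebook N (alpha n) K a ->
  [/\ (n%:R%:E * P (voronoi N (alpha n) a) <= (c1 * (M / m `^ (D / (r + D))))%:E)%E,
      ((n%:R `^ (1 + r / D))%:E * local_inertia N r P (voronoi N (alpha n) a) a
       <= (c2 * (M / m))%:E)%E,
      ((c3 * m `^ (r / (r + D)))%:E <= n%:R%:E * P (open_voronoi N (alpha n) a))%E &
      ((c4 * (m / M) `^ (r / D))%:E <= (n%:R `^ (1 + r / D))%:E *
         local_inertia N r P (open_voronoi N (alpha n) a) a)%E].
  move=> e0 m0 M0 hi hs.
  have hi' : (m%:E <= hinf e)%E by rewrite hi.
  have hs' : (hsup e <= M%:E)%E by rewrite hs.
  split; first exact: (ess_inf_le_sup hN hPh e0 Kk (ltW m0) (ltW M0) hi' hs').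
  have PM E := @prob_le_ess_sup _ _ N P h hPh K e M E (ltW M0) hs'.
  have Pm E := @prob_ge_ess_inf _ _ N P h hPh K e m E (ltW m0) hi'.
  have [n0 H] := HB K e m M e0 m0 M0 PM Pm.
  exists n0 => n a n0n npos; rewrite (HS n npos).1 => /(H _ _ n0n)[[_ ? ? ? ?]].
  by split.
have npos n : (0 < n)%N -> 0 < n%:R :> R by rewrite ltr0n.
have nrpos n : (0 < n)%N -> 0 < n%:R `^ (1 + r / D) :> R.
  by move=> n0; rewrite powR_gt0 ?npos.
have lower_prob p : 0 < p -> (c3%:E * ereal_sup [set (hinf e / hsup e) `^ p *
    hinf e `^ (r / (r + D)) | e in pos] <= limn_einf (fun n => n%:R%:E *
    ereal_inf [set P (open_voronoi N (alpha n) a)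
              | a in near_codebook N (alpha n) K]))%E.
  move=> p0; apply: pmul_ereal_sup_le => // e e0.
  have zero : (0 <= limn_einf (fun n => n%:R%:E *
      ereal_inf [set P (open_voronoi N (alpha n) a)
                | a in near_codebook N (alpha n) K]))%E.
    apply: limn_einf_ge_near; exists 0%N => n _; rewrite mule_ge0 ?lee_fin//.
    by apply: le_ereal_inf_tmp => _ [a _ <-]; exact: measure_ge0.
  case: (hcases e e0) => [[-> _]|[_ ->]|[m [M [m0 M0 hi hs]]]].
  - by rewrite mul0e (poweR0r (lt0r_neq0 p0)) mul0e mule0.
  - by rewrite dive_y poweR0r ?gt_eqF// mul0e mule0.
  have [mM [n0 H]] := hbounds e m M e0 m0 M0 hi hs.
  rewrite hi hs EFin_div ?gt_eqF// !poweR_EFin -!EFinM.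
  apply: limn_einf_ge_near; exists (maxn 1 n0) => n; rewrite geq_max => /andP[n1 n0n].
  apply: pmul_ereal_inf_ge => [|a an]; first exact: npos.
  have [_ _ B _] := H n a n0n n1 an; apply: le_trans B.
  rewrite lee_fin ler_pM2l// ler_piMl ?powR_ge0//.
  rewrite -(powRr0 (m / M)); apply: ger_powR; last exact: ltW.
  by rewrite divr_gt0//= ler_pdivrMr// mul1r.
have lower_inertia p : r / D <= p -> (c4%:E *
    ereal_sup [set (hinf e / hsup e) `^ p | e in pos] <=
    limn_einf (fun n => (n%:R `^ (1 + r / D))%:E *
      ereal_inf [set local_inertia N r P (open_voronoi N (alpha n) a) a
                | a in near_codebook N (alpha n) K]))%E.
  move=> rp; have p0 : 0 < p by apply: lt_le_trans rp; exact: divr_gt0.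
  apply: pmul_ereal_sup_le => // e e0.
  have zero : (0 <= limn_einf (fun n => (n%:R `^ (1 + r / D))%:E *
      ereal_inf [set local_inertia N r P (open_voronoi N (alpha n) a) a
                | a in near_codebook N (alpha n) K]))%E.
    apply: limn_einf_ge_near; exists 0%N => n _.
    rewrite mule_ge0 ?lee_fin ?powR_ge0//.
    apply: le_ereal_inf_tmp => _ [a _ <-].
    by apply: integral_ge0 => x _; rewrite lee_fin powR_ge0.
  case: (hcases e e0) => [[-> _]|[_ ->]|[m [M [m0 M0 hi hs]]]].
  - by rewrite mul0e poweR0r ?gt_eqF// mule0.
  - by rewrite dive_y poweR0r ?gt_eqF// mule0.
  have [mM [n0 H]] := hbounds e m M e0 m0 M0 hi hs.
  rewrite hi hs EFin_div ?gt_eqF// poweR_EFin -EFinM.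
  apply: limn_einf_ge_near; exists (maxn 1 n0) => n; rewrite geq_max => /andP[n1 n0n].
  apply: pmul_ereal_inf_ge => [|a an]; first exact: nrpos.
  have [_ _ _ B] := H n a n0n n1 an; apply: le_trans B.
  rewrite lee_fin ler_pM2l//; apply: ger_powR => //.
  by rewrite divr_gt0//= ler_pdivrMr// mul1r.
split.
- apply: pmul_ereal_inf_ge => // e e0.
  case: (hcases e e0) => [[-> hs]|[[m m0 ->] ->]|[m [M [m0 M0 hi hs]]]].
  + by rewrite poweR0r ?gt_eqF ?divr_gt0// gt0_dive0// gt0_muley ?lte_fin// leey.
  + by rewrite poweR_EFin divye ?powR_gt0// gt0_muley ?lte_fin// leey.
  have [_ [n0 H]] := hbounds e m M e0 m0 M0 hi hs.
  rewrite hi hs poweR_EFin EFin_div ?gt_eqF ?powR_gt0// -EFinM.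
  apply: limn_esup_le_near; exists (maxn 1 n0) => n; rewrite geq_max => /andP[n1 n0n].
  apply: pmul_ereal_sup_le => [|a an]; first exact: npos.
  by have [] := H n a n0n n1 an.
- apply: pmul_ereal_inf_ge => // e e0.
  case: (hcases e e0) => [[-> hs]|[[m m0 ->] ->]|[m [M [m0 M0 hi hs]]]].
  + by rewrite gt0_dive0// gt0_muley ?lte_fin// leey.
  + by rewrite divye// gt0_muley ?lte_fin// leey.
  have [_ [n0 H]] := hbounds e m M e0 m0 M0 hi hs.
  rewrite hi hs EFin_div ?gt_eqF// -EFinM.
  apply: limn_esup_le_near; exists (maxn 1 n0) => n; rewrite geq_max => /andP[n1 n0n].
  apply: pmul_ereal_sup_le => [|a an]; first exact: nrpos.
  by have [] := H n a n0n n1 an.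
- by case: ifPn => r1; apply: lower_prob => //; exact: divr_gt0.
- have rDr : r / D <= r by rewrite ler_pdivrMr// ler_peMr// ltW.
  case: ifPn => r1; apply: lower_inertia.
    by rewrite (le_trans rDr)// lerDl ltW.
  rewrite (le_trans rDr)//; move: r1; rewrite -ltNge => /ltW r1.
  by rewrite (le_trans r1)// lerDl ltW// divr_gt0.
Qed.
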